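(* Assume (A3), (A4), let $q\in(0,1)$, $p\in(0,2]$ with $p<q+1$, and let $x$ be a bounded trajectory solution of (MTRIGS) with initial data $(x_0,v_0)$. Then $x(t)$ converges strongly, as $t\to+\infty$, to a weak Pareto optimal point $x^*$ of $\min_{x\in\mathcal H}F(x)$, and $x^*$ is the element of minimum norm of $\bigcap_{i=1}^m\{x\in\mathcal H: f_i(x)\le f_i(x^* )\}$.
   Context: $\mathcal H$ real Hilbert space; $f_1,\dots,f_m:\mathcal H\to\mathbb R$ convex, continuously differentiable with Lipschitz continuous gradients; $F=(f_1,\dots,f_m)^\top$. Weak Pareto optimal: no $x$ with $f_i(x)<f_i(x^* )$ for all $i$; $\mathcal P_w$ the set of such points. $\mathcal L(F,b):=\{x:f_i(x)\le b_i\ \forall i\}$, $\mathcal{LP}_w(F,b):=\mathcal L(F,b)\cap\mathcal P_w$. Parameters $t_0>0$, $\alpha,\beta>0$, $q\in(0,1]$, $p\in(0,2]$, initial data $x_0,v_0\in\mathcal H$; $C(x):=\operatorname{conv}\{\nabla f_i(x)\}$. A trajectory solution of (MTRIGS) is $x:[t_0,\infty)\to\mathcal H$, continuously differentiable, with $\dot x$ absolutely continuous on each $[t_0,T]$ and a.e. derivative $\ddot x$ (Bochner measurable, $\dot x(t)=\dot x(t_0)+\int_{t_0}^t\ddot x$), satisfying $\frac{\alpha}{t^q}\dot x(t)+\operatorname{proj}_{C(x(t))+\frac{\beta}{t^p}x(t)+\ddot x(t)}(0)=0$ for a.e. $t\ge t_0$, $x(t_0)=x_0$, $\dot x(t_0)=v_0$.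 (A3): with $a_i:=\frac{\beta}{2t_0^p}\|x_0\|^2+\frac12\|v_0\|^2$, for every $x\in\mathcal L(F,F(x_0)+a)$, $\mathcal{LP}_w(F,F(x))\ne\emptyset$, and $R:=\sup_{F^*\in F(\mathcal{LP}_w(F,F(x_0)+a))}\inf_{z\in F^{-1}(\{F^*\})}\|z\|<\infty$. (A4): $S(w):=\operatorname{argmin}_z\max_i(f_i(z)-w_i)\neq\emptyset$ for all $w\in\mathbb R^m$ and $w\mapsto\operatorname{proj}_{S(w)}(0)$ is continuous. *)

(* Defs.v *)
From HB Require Import structures.
From mathcomp Require Import all_boot all_order all_algebra.
From mathcomp Require Import all_classical all_reals all_analysis.
Set Implicit Arguments. Unset Strict Implicit. Unset Printing Implicit Defensive.
Import Order.TTheory GRing.Theory Num.Theory.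
Import numFieldNormedType.Exports.
Local Open Scope classical_set_scope.
Local Open Scope ring_scope.

Section Defs.
Context {R : realType} {H : normedModType R}.

Definition is_inner_product (inner : H -> H -> R) : Prop :=
  [/\ forall x y, inner x y = inner y x,
      forall a x y z, inner (a *: x + y) z = a * inner x z + inner y z
    & forall x, inner x x = `|x| ^+ 2].

Definition is_min_norm (S : set H) (y : H) : Prop :=
  S y /\ forall z, S z -> `|y| <= `|z|.

Definition convex_fun (f : H -> R) : Prop :=
  forall (l : R) x y, 0 <= l <= 1 ->
    f (l *: x + (1 - l) *: y) <= l * f x + (1 - l) * f y.

Definition lipschitz_fun (g : H -> H) : Prop :=
  exists L : R, forall x y, `|g x - g y| <= L * `|x - y|.

Definition is_gradient (inner : H -> H -> R) (f : H -> R) (g : H -> H) : Prop :=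
  forall x, differentiable f x /\ ('d f x : H -> R) = inner (g x).

Definition conv_hull {m : nat} (v : 'I_m -> H) : set H :=
  [set \sum_(i < m) l i *: v i | l in
     [set l : 'I_m -> R | (forall i, 0 <= l i) /\ \sum_(i < m) l i = 1]].

Definition level_set {m : nat} (f : 'I_m -> H -> R) (b : 'I_m -> R) : set H :=
  [set x | forall i, f i x <= b i].

Definition weak_pareto {m : nat} (f : 'I_m -> H -> R) : set H :=
  [set xs | ~ exists x, forall i, f i x < f i xs].

Definition abs_cont_on (a b : R) (u : R -> H) : Prop :=
  forall e : R, 0 < e -> exists2 d : R, 0 < d &
    forall (n : nat) (s t : 'I_n -> R),
      (forall k, a <= s k /\ s k <= t k /\ t k <= b) ->
      (forall k l, k != l -> t k <= s l \/ t l <= s k) ->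
      \sum_(k < n) (t k - s k) < d ->
      \sum_(k < n) `|u (t k) - u (s k)| < e.

(* max_i (f_i z - w_i), as an extended real (finite when m > 0) *)
Definition max_shift {m : nat} (f : 'I_m -> H -> R) (w : 'I_m -> R) (z : H)
  : \bar R := \big[Order.max/-oo%E]_(i < m) ((f i z - w i)%:E).

Definition argmin_max {m : nat} (f : 'I_m -> H -> R) (w : 'I_m -> R) : set H :=
  [set z | forall z', (max_shift f w z <= max_shift f w z')%E].

End Defs.

(* Main.v *)
(** With [eps = beta / t^p], [gam = alpha / t^q], each energy
    [W_i = f_i (x) + eps/2 |x|^2 + |x'|^2/2] decreases at least at the common rate
    [gam |x'|^2 + p/(2t) eps |x|^2]; let [w_i] be its limit and [J] the total
    dissipation still to come, so that [W_i >= w_i + J].  For an anchor [z] with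
    [f_i z <= w_i], the function [h = |x - z|^2/2] satisfies
    [h'' + gam h' + eps h + J - eps/2 |z|^2 <= 3/2 |x'|^2] almost everywhere.
    Integrating such inequalities over windows [[(1 - xi) b, b]], against a weight
    vanishing at both ends and with the kinetic term absorbed by [J], gives:
    no point has all [f_i z < w_i]; [J = O(eps)]; and, for the minimal-norm point
    [z] of [{f_i <= w_i}] and the moving anchor [x b] used together,
    [|z - x b|^2 -> 0].  The last step uses [J >= eps/2 (|z|^2 - o(1))], which holds
    because [f_i (x t) <= W_i t -> w_i] forces [liminf |x t| >= |z|].  The condition
    [p < q + 1] makes [gam / t] negligible with respect to [eps]. *)
Require Import Defs.
From HB Require Import structures.
From mathcomp Require Import all_boot all_order all_algebra.
From mathcomp Require Import all_classical all_reals all_analysis.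
From mathcomp Require Import measurable_realfun ring lra.
Set Implicit Arguments. Unset Strict Implicit. Unset Printing Implicit Defensive.
Import Order.TTheory GRing.Theory Num.Theory.
Import numFieldNormedType.Exports.
Local Open Scope classical_set_scope.
Local Open Scope ring_scope.

(** * Monotonicity of absolutely continuous functions *)

(** The levels [w i] come out of the trajectory, and the multipliers expressing the projection vary
    with time without control. Every estimate therefore uses a lower bound common to all objectives,
    which survives averaging with any multipliers. Windows have length proportional to [b]: long
    enough for the boundary terms to be small against [eps b], while [eps] changes over them only by
    the factor (1 - xi)^(-p), close to 1 for small [xi]. With two anchors, the terms eps/2
    |anchor|^2 cancel to leading order: [J] pays for [z], and the energy left at time [b] pays for
    [x b]. What remains is [eps] times two half squared distances, whose sum is at least |z - x b|^2
    / 4. The acceleration exists only almost everywhere, so each integration involving it is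
    replaced by the monotonicity of an explicit function that inherits absolute continuity from the
    velocity. (A4) enters at the end: no point lies strictly below [w], yet the trajectory gets
    below [w + d] for every [d > 0], so {f_i <= w_i} is the set of minimizers of max_i (f_i - w_i),
    and has an element of minimal norm. *)

Lemma interval_induction (R : realType) (a b : R) (P : R -> Prop) :
  a <= b -> P a ->
  (forall c, a <= c <= b -> exists2 r, 0 < r &
     forall s t, a <= s -> s <= c -> c <= t -> t <= b ->
       c - s < r -> t - c < r -> P s -> P t) ->
  P b.
Proof.
move=> ab Pa step.
pose S := [set c | a <= c <= b /\ P c].
have Sa : S a by split=> //; rewrite lexx.
have ubS : ubound S b by move=> c [/andP[]].
have hS : has_sup S by split; [exists a | exists b].
have supa : a <= sup S by apply: ub_le_sup => //; exists b.
have supb : sup S <= b by apply: ge_sup => //; exists a.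
have [|r r0 stepr] := step (sup S); first by rewrite supa.
have [s [/andP[as_ sb] Ps] sups] := sup_adherent r0 hS.
have ssup : s <= sup S by apply: ub_le_sup => //; [exists b | split; rewrite ?as_].
(* One step jumps over [sup S], cut off at [b]: landing strictly beyond the supremum is impossible,
   so the landing point is [b] itself. *)
pose t := Num.min b (sup S + r / 2).
have tb : t <= b by rewrite ge_min lexx.
have supt : sup S <= t by rewrite le_min supb/=; lra.
have tr : t <= sup S + r / 2 by rewrite ge_min lexx orbT.
have Pt : P t by apply: (stepr s t) => //; lra.
have : t <= sup S.
  by apply: ub_le_sup; [exists b|split=> //; rewrite tb (le_trans supa)].
rewrite ge_min => /orP[bs|]; last by lra.
suff -> : b = t by [].
by apply/eqP; rewrite eq_le tb andbT (le_trans bs).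
Qed.

(** Splitting the increment at [t] leaves two difference quotients based at [t], one from each side.
    Letting both end points move is what interval induction requires. *)
Lemma is_derive_straddle (R : realType) (G : R -> R) (t d e : R) :
  is_derive t 1 G d -> d < e ->
  exists2 r, 0 < r & forall s u, s <= t -> t <= u -> t - s < r -> u - t < r ->
    G u - G s <= e * (u - s).
Proof.
move=> [dG Gd] de.
have : h^-1 *: ((G \o shift t) (h *: 1) - G t) @[h --> 0^'] --> d.
  by rewrite -Gd; exact: dG.
move=> /cvgrPdist_lt/(_ (e - d)); rewrite subr_gt0 => /(_ de).
move=> /nbhs_ballP[r /= r0 hr]; exists r => // s u st tu tsr utr.
have key h : h != 0 -> `|h| < r -> h^-1 * (G (h + t) - G t) < e.
  move=> h0 hr'; have := hr h; rewrite /ball/= sub0r normrN => /(_ hr' h0).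
  by rewrite [_ *: 1]mulr1 /GRing.scale/= distrC => /ltr_distlDr; lra.
have right : G u - G t <= e * (u - t).
  have [->|ut] := eqVneq u t; first by rewrite !subrr mulr0.
  have ut0 : 0 < u - t by rewrite subr_gt0 lt_neqAle eq_sym ut.
  have := key (u - t); rewrite subrK gt_eqF//= gtr0_norm// => /(_ isT utr).
  by rewrite mulrC ltr_pdivrMr// => /ltW.
have left : G t - G s <= e * (t - s).
  have [->|ts] := eqVneq t s; first by rewrite !subrr mulr0.
  have ts0 : 0 < t - s by rewrite subr_gt0 lt_neqAle eq_sym ts.
  have st0 : s - t < 0 by rewrite -oppr_gt0 opprB.
  have := key (s - t); rewrite subrK lt_eqF// distrC gtr0_norm// => /(_ isT tsr).
  by rewrite -[s - t]opprB invrN mulNr -mulrN opprB mulrC ltr_pdivrMr// => /ltW.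
by lra.
Qed.

Section abs_cont_monotone.
Context {R : realType}.
Let mu : {measure set (measurableTypeR R) -> \bar R} := @lebesgue_measure R.

(** The covering argument appends one interval at a time on the right, which ordered lists express
    more directly than indexed families. *)
Lemma abs_cont_on_seq (V : normedModType R) (u : R -> V) (a b e : R) :
  abs_cont_on a b u -> 0 < e -> exists2 d : R, 0 < d &
    forall l : seq (R * R),
      all (fun p => [&& a <= p.1, p.1 <= p.2 & p.2 <= b]) l ->
      pairwise (fun p p' => p.2 <= p'.1) l ->
      \sum_(p <- l) (p.2 - p.1) < d ->
      \sum_(p <- l) `|u p.2 - u p.1| < e.
Proof.
move=> ac e0; have [d d0 acd] := ac e e0; exists d => // l /allP lab /pairwiseP lp.
rewrite !(big_nth (0, 0)) !big_mkord => sd.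
apply: (acd (size l) (fun k => (nth (0, 0) l k).1) (fun k => (nth (0, 0) l k).2)) => //.
  by move=> k; have /lab/and3P[] := mem_nth (0, 0) (ltn_ord k).
move=> k k' kk'; have [kk|kk|/val_inj kk] := ltngtP k k'.
- by left; apply: (lp (0, 0)) kk; rewrite inE.
- by right; apply: (lp (0, 0)) kk; rewrite inE.
- by rewrite kk eqxx in kk'.
Qed.

Lemma negligible_open_cover (N : set R) (d : R) :
  mu.-negligible N -> 0 < d ->
  exists U : set R, [/\ open U, N `<=` U & (mu U < d%:E)%E].
Proof.
move=> [A [mA A0 NA]] d0.
have [|U [oU AU UA]] := @lebesgue_regularity_outer R A d mA _ d0.
  by change (mu A < +oo)%E; rewrite A0 ltry.
exists U; split=> //; first exact: subset_trans NA AU.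
have mU : measurable (U : set (measurableTypeR R)) by exact: open_measurable.
apply: le_lt_trans UA.
have -> : mu U = (mu (U `\` A) + mu (U `&` A))%E.
  rewrite -measureU; [|exact: measurableD|exact: measurableI|].
    by rewrite setDE -setIUr setUC setUv setIT.
  by rewrite setDE setIACA setICl setI0.
have -> : mu (U `&` A) = 0%E.
  by apply/eqP; rewrite -measure_le0 -A0; apply: le_measure; rewrite ?inE//; exact: measurableI.
by rewrite adde0.
Qed.

(** Keeps account of the total length of the intervals inside the cover: half-open pieces make the
    measure additive as the chain advances. *)
Lemma lebesgue_measure_co_step (U : set R) (a c d : R) :
  open U -> a <= c -> c < d -> `[c, d]%classic `<=` U ->
  (mu (U `&` `[a, c[) + (d - c)%:E <= mu (U `&` `[a, d[))%E.
Proof.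
move=> oU ac cd cdU.
have mU : measurable (U : set (measurableTypeR R)) by exact: open_measurable.
have -> : (d - c)%:E = mu `[c, d[%classic.
  by rewrite [RHS]lebesgue_measure_itv/= lte_fin cd.
rewrite -measureU//; last 2 first.
- exact: measurableI.
- apply/seteqP; split=> // z [[_ /=]]; rewrite !in_itv/= => /andP[_ zc] /andP[cz _].
  by move: (lt_le_trans zc cz); rewrite ltxx.
apply: le_measure; rewrite ?inE.
- by apply: measurableU => //; exact: measurableI.
- exact: measurableI.
move=> z [[Uz]|]/=; rewrite !in_itv/= => /andP[az zc].
  by split=> //; rewrite ?in_itv/= az (lt_trans zc).
split; first by apply: cdU; rewrite /= in_itv/= az ltW.
by rewrite ?in_itv/= zc (le_trans ac).
Qed.

(* Cover the exceptional set by an open set of small measure; a chain of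
   intervals, each either a good straddling interval or contained in the cover,
   links [a] to [b]. *)
Lemma abs_cont_ae_nonincreasing (V : normedModType R) (u : R -> V) (G : R -> R)
    (a b K : R) :
  a <= b -> abs_cont_on a b u ->
  (forall s t, a <= s -> s <= t -> t <= b ->
     `|G t - G s| <= K * (`|u t - u s| + (t - s))) ->
  {ae mu, forall t, a < t < b -> exists2 d, is_derive t 1 G d & d <= 0} ->
  G b <= G a.
Proof.
move=> ab ac GK Gae; apply/ler_addgt0Pr => e e0.
wlog K0 : K GK / 0 < K.
  move=> wl; apply: (wl (Num.max K 1)); last by rewrite lt_max ltr01 orbT.
  move=> s t as_ st tb; apply: le_trans (GK s t as_ st tb) _.
  by apply: ler_wpM2r; rewrite ?le_max ?lexx// addr_ge0// subr_ge0.
(* [e1] is the slope tolerated on good intervals, at a total cost of at most [e / 2]. On the others,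
   the variation of [u] and the total length are each below [e2], at a cost of at most
   [2 * K * e2 = e / 2]. *)
pose e1 := e / (2 * (b - a + 1)); pose e2 := e / (4 * K).
have ba1 : 0 < b - a + 1 by lra.
have e10 : 0 < e1 by rewrite divr_gt0// mulr_gt0.
have e20 : 0 < e2 by rewrite divr_gt0// mulr_gt0.
have [d d0 acd] := abs_cont_on_seq ac e20.
(* Nothing is known about derivatives at the end points, so they join the exceptional set. *)
pose N := ~` [set t | a < t < b -> exists2 d, is_derive t 1 G d & d <= 0] `|` [set a] `|` [set b].
have Nneg : mu.-negligible N.
  apply: negligibleU; [apply: negligibleU => //|].
    by exists [set a]; split=> //; exact: lebesgue_measure_set1.
  by exists [set b]; split=> //; exact: lebesgue_measure_set1.
have d'0 : 0 < Num.min d e2 by rewrite lt_min d0.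
have [U [oU NU muU]] := negligible_open_cover Nneg d'0.
(* The invariant lists only the intervals inside the cover; good intervals leave no trace but the
   term [e1 * (c - a)]. *)
pose P c := exists l : seq (R * R),
  [/\ all (fun p => [&& a <= p.1, p.1 <= p.2 & p.2 <= c]) l,
      pairwise (fun p p' => p.2 <= p'.1) l,
      ((\sum_(p <- l) (p.2 - p.1))%:E <= mu (U `&` `[a, c[))%E &
      G c <= G a + e1 * (c - a) + \sum_(p <- l) (K * (`|u p.2 - u p.1| + (p.2 - p.1)))].
have mU : measurable (U : set (measurableTypeR R)) by exact: open_measurable.
have [l [lab lp lmu Gb]] : P b; last first.
  have lb : \sum_(p <- l) (p.2 - p.1) < Num.min d e2.
    rewrite -lte_fin; apply: le_lt_trans muU; apply: le_trans lmu _.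
    by apply: le_measure; rewrite ?inE//; exact: measurableI.
  move: (lb); rewrite lt_min => /andP[ld le2].
  have := acd l lab lp ld; move: Gb le2; rewrite -mulr_sumr big_split/=.
  set S1 := \sum_(p <- l) (p.2 - p.1); set S2 := \sum_(p <- l) _.
  move=> Gb le2 S2e.
  have H1 : e1 * (b - a) <= e / 2.
    have -> : e1 * (b - a) = e / 2 * ((b - a) / (b - a + 1)).
      by rewrite /e1; field; rewrite gt_eqF.
    apply: ler_piMr; first by rewrite divr_ge0 ?ltW.
    by rewrite ler_pdivrMr// mul1r; lra.
  have H2 : K * (S2 + S1) <= e / 2.
    have -> : e / 2 = K * (e2 + e2) by rewrite /e2; field; rewrite gt_eqF.
    by rewrite ler_pM2l// lerD// ltW.
  lra.
apply: (@interval_induction R a b P ab).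
  by exists [::]; split=> //; rewrite !big_nil ?subrr ?mulr0 ?addr0// measure_ge0.
move=> c /andP[a_c cb].
have [Nc|Nc] := pselect (N c).
  have : nbhs c U by apply: open_nbhs_nbhs; split=> //; exact: NU.
  move=> /nbhs_ballP[r /= r0 rU]; exists r => // s t as_ sc ct tb csr tcr [l [lab lp lmu Gl]].
  have [st|st] := eqVneq s t; first by exists l; rewrite -st.
  have {}st : s < t by rewrite lt_neqAle st (le_trans sc).
  exists (rcons l (s, t)); split.
  - rewrite all_rcons/= as_ (ltW st) lexx/=; apply: sub_all lab => p /and3P[-> ->/=].
    by move=> /le_trans; apply; exact: ltW.
  - by rewrite pairwise_rcons lp andbT; apply: sub_all lab => p /and3P[].
  - rewrite -cats1 big_cat big_seq1/= EFinD.
    apply: le_trans (@lebesgue_measure_co_step U a s t oU as_ st _); first exact: leeD2r.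
    move=> z /=; rewrite in_itv/= => /andP[sz zt]; apply: rU; rewrite /ball/= ltr_distl.
    by apply/andP; split; lra.
  rewrite -cats1 big_cat big_seq1/=.
  have := GK s t as_ (ltW st) tb; move=> /(le_trans (ler_norm _)).
  have : 0 <= e1 * (t - s) by rewrite mulr_ge0 ?ltW// subr_gt0.
  by lra.
move/not_orP : Nc => [/not_orP[Nc ca'] cb'].
have {}a_c : a < c by rewrite lt_neqAle a_c andbT eq_sym; exact/eqP.
have {}cb : c < b by rewrite lt_neqAle cb andbT; exact/eqP.
have /= := contrapT Nc; rewrite a_c cb => /(_ isT)[k Gk k0].
have [r r0 hr] := is_derive_straddle Gk (le_lt_trans k0 e10).
exists r => // s t as_ sc ct tb csr tcr [l [lab lp lmu Gl]].
exists l; split=> //.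
- by apply: sub_all lab => p /and3P[-> ->/=] /le_trans; apply; exact: le_trans ct.
- apply: le_trans lmu _; apply: le_measure; rewrite ?inE; [exact: measurableI|exact: measurableI|].
  apply: setIS => z/=; rewrite !in_itv/= => /andP[-> zs]/=; apply: (lt_le_trans zs).
  exact: le_trans ct.
have := hr s t sc ct csr tcr; lra.
Qed.

End abs_cont_monotone.

(** * Inner products *)

Section inner_product.
Context {R : realType} {H : normedModType R} (inner : H -> H -> R).
Hypothesis inner_ip : is_inner_product inner.

Lemma innerC x y : inner x y = inner y x.
Proof. by have [h _ _] := inner_ip; exact: h. Qed.

Lemma inner_sqr x : inner x x = `|x| ^+ 2.
Proof. by have [_ _ h] := inner_ip; exact: h. Qed.

Lemma innerDl x y z : inner (x + y) z = inner x z + inner y z.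
Proof. by have [_ h _] := inner_ip; rewrite -{1}[x]scale1r h mul1r. Qed.

Lemma inner0l z : inner 0 z = 0.
Proof. by apply: (addIr (inner 0 z)); rewrite -innerDl !add0r. Qed.

Lemma innerZl a x z : inner (a *: x) z = a * inner x z.
Proof. by have [_ h _] := inner_ip; rewrite -[a *: x]addr0 h inner0l addr0. Qed.

Lemma innerNl x z : inner (- x) z = - inner x z.
Proof. by rewrite -scaleN1r innerZl mulN1r. Qed.

Lemma innerBl x y z : inner (x - y) z = inner x z - inner y z.
Proof. by rewrite innerDl innerNl. Qed.

Lemma innerDr x y z : inner z (x + y) = inner z x + inner z y.
Proof. by rewrite innerC innerDl !(innerC z). Qed.

Lemma innerZr a x z : inner z (a *: x) = a * inner z x.
Proof. by rewrite innerC innerZl innerC. Qed.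

Lemma innerNr x z : inner z (- x) = - inner z x.
Proof. by rewrite innerC innerNl innerC. Qed.

Lemma innerBr x y z : inner z (x - y) = inner z x - inner z y.
Proof. by rewrite innerDr innerNr. Qed.

Lemma inner_suml m (l : 'I_m -> R) (v : 'I_m -> H) z :
  inner (\sum_(i < m) l i *: v i) z = \sum_(i < m) l i * inner (v i) z.
Proof.
elim/big_ind2 : _ => [|x a y b <- <-|i _]; first by rewrite inner0l.
  by rewrite innerDl.
by rewrite innerZl.
Qed.

Lemma normD_sqr (x y : H) : `|x + y| ^+ 2 = `|x| ^+ 2 + 2 * inner x y + `|y| ^+ 2.
Proof. by rewrite -!inner_sqr !(innerDl, innerDr) (innerC y x); ring. Qed.

Lemma normB_sqr (x y : H) : `|x - y| ^+ 2 = `|x| ^+ 2 - 2 * inner x y + `|y| ^+ 2.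
Proof. by rewrite normD_sqr innerNr normrN mulrN. Qed.

Lemma inner_polar x y : inner x y = 4^-1 * (`|x + y| ^+ 2 - `|x - y| ^+ 2).
Proof. by rewrite normD_sqr normB_sqr; field. Qed.

Lemma parallelogram (x y : H) :
  `|x - y| ^+ 2 =
  2 * `|x| ^+ 2 + 2 * `|y| ^+ 2 - 4 * `|2^-1 *: x + 2^-1 *: y| ^+ 2.
Proof.
rewrite normB_sqr normD_sqr !normrZ innerZl innerZr.
have -> : `|2^-1 : R| = 2^-1 by rewrite ger0_norm.
by field.
Qed.

Lemma cauchy_schwarz x y : `|inner x y| <= `|x| * `|y|.
Proof.
have [->|y0] := eqVneq y 0.
  by rewrite innerC inner0l normr0 mulr_ge0.
have ny : 0 < `|y| by rewrite normr_gt0.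
rewrite -(@ler_pXn2r _ 2) ?nnegrE ?mulr_ge0// real_normK ?num_real//.
have := sqr_ge0 `|(`|y| ^+ 2 : R) *: x - inner x y *: y|.
rewrite normB_sqr !normrZ innerZl innerZr !exprMn !real_normK ?num_real// => h.
have {}h : 0 <= `|y| ^+ 2 * ((`|x| * `|y|) ^+ 2 - inner x y ^+ 2).
  by apply: le_trans h _; rewrite le_eqVlt; apply/orP; left; apply/eqP; ring.
by move: h; rewrite pmulr_rge0 ?exprn_gt0// subr_ge0 exprMn.
Qed.

Lemma cvg_inner (T : Type) (F : set_system T) (FF : Filter F) (u v : T -> H) a b :
  u @ F --> a -> v @ F --> b -> inner (u t) (v t) @[t --> F] --> inner a b.
Proof.
move=> ua vb.
have -> : (fun t => inner (u t) (v t)) =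
    (fun t => 4^-1 * (`|u t + v t| * `|u t + v t| - `|u t - v t| * `|u t - v t|)).
  by apply/funext => t; rewrite inner_polar !expr2.
rewrite inner_polar !expr2.
apply: cvgM; first exact: cvg_cst.
by apply: cvgB; apply: cvgM; apply: cvg_norm; (exact: cvgD || exact: cvgB).
Qed.

Lemma is_derive_cvg (W : normedModType R) (u : R -> W) (t : R) du :
  is_derive t 1 u du <-> h^-1 *: (u (h + t) - u t) @[h --> 0^'] --> du.
Proof.
have E : (fun h : R => h^-1 *: (u (h + t) - u t)) =
         (fun h : R => h^-1 *: ((u \o shift t) (h *: 1) - u t)).
  by apply/funext => h /=; rewrite [_ *: 1]mulr1.
rewrite E; split=> [[dux <-]|cu]; first exact: dux.
split; last exact: cvg_lim cu.
by apply/cvg_ex; exists du.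
Qed.

Lemma is_derive_continuous (W : normedModType R) (u : R -> W) (t : R) du :
  is_derive t 1 u du -> {for t, continuous u}.
Proof.
by move=> [+ _] => /derivable1_diffP/differentiable_continuous.
Qed.

Lemma is_derive_inner (u v : R -> H) (t : R) du dv :
  is_derive t 1 u du -> is_derive t 1 v dv ->
  is_derive t 1 (fun s => inner (u s) (v s)) (inner du (v t) + inner (u t) dv).
Proof.
move=> Du Dv; have cv := is_derive_continuous Dv.
move/is_derive_cvg : Du => Du; move/is_derive_cvg : Dv => Dv.
apply/is_derive_cvg.
have -> : (fun h : R => h^-1 *: (inner (u (h + t)) (v (h + t)) - inner (u t) (v t))) =
  (fun h : R => inner (h^-1 *: (u (h + t) - u t)) (v (h + t)) +
                inner (u t) (h^-1 *: (v (h + t) - v t))).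
  apply/funext => h; rewrite !(innerZl, innerZr, innerBl, innerBr).
  by rewrite /GRing.scale/=; ring.
apply: cvgD; apply: cvg_inner => //; last exact: cvg_cst.
have h : (h + t) @[h --> 0^'] --> t.
  rewrite -[X in _ --> X](add0r t); apply: cvgD; last exact: cvg_cst.
  exact: nbhs_dnbhs.
exact: (cvg_comp _ _ h cv).
Qed.

Lemma is_derive_norm_sqr (u : R -> H) (t : R) du :
  is_derive t 1 u du ->
  is_derive t 1 (fun s => `|u s| ^+ 2) (2 * inner du (u t)).
Proof.
move=> Du.
have -> : (fun s => `|u s| ^+ 2) = (fun s => inner (u s) (u s)).
  by apply/funext => s; rewrite inner_sqr.
by rewrite mulr_natl mulr2n {2}innerC; exact: is_derive_inner.
Qed.

Lemma is_derive_gradient (f : H -> R) (g : H -> H) (u : R -> H) (t : R) du :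
  is_gradient inner f g -> is_derive t 1 u du ->
  is_derive t 1 (f \o u) (inner (g (u t)) du).
Proof.
move=> fg Du; have [df dE] := fg (u t).
have du1 : differentiable u t by case: Du => + _ => /derivable1_diffP.
have D : differentiable (f \o u) t by exact: differentiable_comp.
split; first exact: diff_derivable.
rewrite deriveE// diff_comp//= dE -(deriveE _ du1).
by case: Du => _ ->.
Qed.

(** If the slope at [x] towards [y] exceeded the slope of the chord, short steps would beat the mean
    of the two slopes, which convexity forbids. *)
Lemma convex_gradient_ineq (f : H -> R) (g : H -> H) x y :
  convex_fun f -> is_gradient inner f g -> inner (g x) (y - x) <= f y - f x.
Proof.
move=> cf fg.
have D0 : is_derive (0 : R) 1 (fun s : R => x + s *: (y - x)) (y - x).
  apply/is_derive_cvg; apply: cvg_near_cst; near=> h.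
  rewrite scale0r !addr0 addrC addKr scalerA mulVf ?scale1r//.
  by near: h; exact: nbhs_dnbhs_neq.
have D := is_derive_gradient fg D0.
rewrite /= scale0r addr0 in D.
set k := inner _ _ in D *; rewrite leNgt; apply/negP => ck.
have DN : is_derive (0 : R) 1 (- (f \o (fun s : R => x + s *: (y - x)))) (- k).
  exact: is_deriveN.
have kc : - k < - ((f y - f x + k) / 2) by rewrite ltrN2; lra.
have [r r0 hr] := is_derive_straddle DN kc.
pose s := Num.min 1 (r / 2).
have s0 : 0 < s by rewrite lt_min ltr01 divr_gt0.
have s1 : s <= 1 by rewrite ge_min lexx.
have sr : s <= r / 2 by rewrite ge_min lexx orbT.
have := hr 0 s (lexx _) (ltW s0); rewrite subrr subr0 => /(_ r0).
have sr' : s < r by lra.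
move=> /(_ sr'); rewrite /= !fctE/= scale0r addr0.
have := cf s y x; rewrite (ltW s0) s1 => /(_ isT).
have -> : s *: y + (1 - s) *: x = x + s *: (y - x).
  by rewrite scalerBl scale1r scalerBr addrC addrAC addrA.
have : s * (f y - f x) < s * ((f y - f x + k) / 2) by rewrite ltr_pM2l//; lra.
lra.
Unshelve. all: by end_near. Qed.

End inner_product.

(** * Functions with increments controlled by those of an absolutely continuous function *)

Section tracked.
Context {R : realType} {V : normedModType R} (u : R -> V) (a b : R).

(* [G] inherits absolute continuity on [a, b] from [u]. *)
Definition tracked_by (W : normedModType R) (G : R -> W) :=
  exists K, forall s t, a <= s -> s <= t -> t <= b ->
    `|G t - G s| <= K * (`|u t - u s| + (t - s)).

Definition bounded_fun_on (W : normedModType R) (G : R -> W) :=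
  exists M, forall t, a <= t -> t <= b -> `|G t| <= M.

Lemma tracked_self : tracked_by u.
Proof. by exists 1 => s t _ st _; rewrite mul1r lerDl subr_ge0. Qed.

Lemma tracked_cst (W : normedModType R) (c : W) : tracked_by (fun=> c).
Proof. by exists 0 => s t _ st _; rewrite subrr normr0 mul0r. Qed.

Lemma trackedD (W : normedModType R) (G1 G2 : R -> W) :
  tracked_by G1 -> tracked_by G2 -> tracked_by (fun t => G1 t + G2 t).
Proof.
move=> [K1 h1] [K2 h2]; exists (K1 + K2) => s t as_ st tb.
rewrite opprD addrACA mulrDl; apply: le_trans (ler_normD _ _) _.
by apply: lerD; [exact: h1|exact: h2].
Qed.

Lemma trackedN (W : normedModType R) (G : R -> W) :
  tracked_by G -> tracked_by (fun t => - G t).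
Proof.
by move=> [K h]; exists K => s t as_ st tb; rewrite -opprD normrN; exact: h.
Qed.

Lemma trackedB (W : normedModType R) (G1 G2 : R -> W) :
  tracked_by G1 -> tracked_by G2 -> tracked_by (fun t => G1 t - G2 t).
Proof. by move=> h1 h2; apply: trackedD => //; exact: trackedN. Qed.

Lemma tracked_lipschitz (W : normedModType R) (G : R -> W) K :
  (forall s t, a <= s -> s <= t -> t <= b -> `|G t - G s| <= K * (t - s)) ->
  tracked_by G.
Proof.
move=> h; exists (`|K|) => s t as_ st tb.
have ts : 0 <= t - s by rewrite subr_ge0.
apply: le_trans (h s t as_ st tb) _.
apply: (@le_trans _ _ (`|K| * (t - s))).
  by apply: ler_wpM2r => //; exact: ler_norm.
by apply: ler_wpM2l; rewrite ?lerDr.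
Qed.

Lemma tracked_id : tracked_by (@id R).
Proof. by apply: (@tracked_lipschitz _ _ 1) => s t _ st _; rewrite mul1r ger0_norm ?subr_ge0. Qed.

Hypothesis bu : bounded_fun_on u.

Lemma tracked_bounded (W : normedModType R) (G : R -> W) :
  tracked_by G -> bounded_fun_on G.
Proof.
move=> [K hK]; have [M hM] := bu.
exists (`|G a| + `|K| * (M + M + (b - a))) => t at_ tb.
have -> : G t = G a + (G t - G a) by rewrite addrC subrK.
apply: le_trans (ler_normD _ _) _; rewrite lerD2l.
have ta : 0 <= t - a by rewrite subr_ge0.
apply: le_trans (hK a t (lexx _) at_ tb) _.
apply: (@le_trans _ _ (`|K| * (`|u t - u a| + (t - a)))).
  by apply: ler_wpM2r; [exact: addr_ge0|exact: ler_norm].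
apply: ler_wpM2l; first exact: normr_ge0.
apply: lerD; last by lra.
apply: le_trans (ler_normB _ _) _; apply: lerD; apply: hM => //.
exact: le_trans tb.
Qed.

(** Stated for an arbitrary bounded bilinear map so as to serve both real products and inner
    products. *)
Lemma tracked_bilinear (W1 W2 W3 : normedModType R) (B : W1 -> W2 -> W3)
    (G1 : R -> W1) (G2 : R -> W2) :
  (forall x y z, B (x - y) z = B x z - B y z) ->
  (forall x y z, B x (y - z) = B x y - B x z) ->
  (forall x y, `|B x y| <= `|x| * `|y|) ->
  tracked_by G1 -> tracked_by G2 ->
  tracked_by (fun t => B (G1 t) (G2 t)).
Proof.
move=> Bl Br Bn d1 d2.
have [M1 hM1] := tracked_bounded d1; have [M2 hM2] := tracked_bounded d2.
have [K1 h1] := d1; have [K2 h2] := d2.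
exists (K1 * M2 + M1 * K2) => s t as_ st tb.
have at_ := le_trans as_ st; have sb := le_trans st tb.
have -> : B (G1 t) (G2 t) - B (G1 s) (G2 s) =
          B (G1 t - G1 s) (G2 t) + B (G1 s) (G2 t - G2 s).
  by rewrite Bl Br addrA subrK.
apply: le_trans (ler_normD _ _) _; rewrite mulrDl; apply: lerD.
  apply: le_trans (Bn _ _) _; rewrite mulrAC; apply: ler_pM => //.
    exact: h1.
  exact: hM2.
apply: le_trans (Bn _ _) _; rewrite -mulrA; apply: ler_pM => //.
  exact: hM1.
exact: h2.
Qed.

Lemma trackedM (G1 G2 : R -> R) :
  tracked_by (G1 : R -> R) -> tracked_by (G2 : R -> R) ->
  tracked_by ((fun t => G1 t * G2 t) : R -> R).
Proof.
apply: (@tracked_bilinear R R R (fun x y => x * y)).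
- by move=> x y z; rewrite mulrBl.
- by move=> x y z; rewrite mulrBr.
- by move=> x y; rewrite normrM.
Qed.

End tracked.

(** * Differentiation on the real line *)

Section real_derivatives.
Context {R : realType}.
Implicit Types (f g : R -> R) (t : R).

Lemma is_derive_fun_add f g t df dg :
  is_derive t 1 f df -> is_derive t 1 g dg ->
  is_derive t 1 (fun s => f s + g s) (df + dg).
Proof. by move=> Df Dg; exact: is_deriveD. Qed.

Lemma is_derive_fun_mul f g t df dg :
  is_derive t 1 f df -> is_derive t 1 g dg ->
  is_derive t 1 (fun s => f s * g s) (df * g t + f t * dg).
Proof.
move=> Df Dg; apply: (is_derive_eq (is_deriveM Df Dg)).
by rewrite /GRing.scale/=; ring.
Qed.

Lemma is_derive_fun_opp f t df :
  is_derive t 1 f df -> is_derive t 1 (fun s => - f s) (- df).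
Proof. by move=> Df; exact: is_deriveN. Qed.

Lemma is_derive_fun_cst (c t : R) : is_derive t 1 (fun=> c) 0.
Proof. exact: is_derive_cst. Qed.

Lemma is_derive_fun_id t : is_derive t 1 (fun s => s) 1.
Proof. exact: is_derive_id. Qed.

(** The derivative is kept as [- (r / t)] times the function itself, the shape in which the decay of
    [eps] enters [dissip]. *)
Lemma is_derive_div_powR (c r t : R) : 0 < t ->
  is_derive t 1 (fun s => c / s `^ r) (- (r / t * (c / t `^ r))).
Proof.
move=> t0.
have -> : (fun s => c / s `^ r) = (fun s => c * s `^ (- r)).
  by apply/funext => s; rewrite powRN.
apply: is_derive_eq.
  exact: (is_derive_fun_mul (is_derive_fun_cst c t) (is_derive1_powR (- r) t0)).
rewrite powRB ?(gt_eqF t0) ?implybT// powRr1 ?ltW// powRN.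
by field; rewrite !gt_eqF// powR_gt0.
Qed.

Lemma powR_eventually_ge (A r : R) : 0 < r ->
  exists2 T : R, 1 <= T & forall b, T <= b -> A <= b `^ r.
Proof.
move=> r0; exists ((1 + `|A|) `^ r^-1).
  apply: le_trans (_ : (1 : R) `^ (r^-1) <= _); first by rewrite powR1.
  apply: ge0_ler_powR; rewrite ?nnegrE ?invr_ge0 ?addr_ge0//; first exact: ltW.
  by rewrite lerDl.
move=> b Tb; apply: le_trans (_ : ((1 + `|A|) `^ r^-1) `^ r <= _); last first.
  apply: ge0_ler_powR; rewrite ?nnegrE ?powR_ge0//; first exact: ltW.
  by apply: le_trans Tb; exact: powR_ge0.
rewrite -powRrM mulVf ?gt_eqF// powRr1 ?addr_ge0//.
by have := ler_norm A; lra.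
Qed.

Lemma div_powR_nonincreasing (c r s t : R) : 0 <= c -> 0 <= r -> 0 < s -> s <= t ->
  c / t `^ r <= c / s `^ r.
Proof.
move=> c0 r0 s0 st; have t0 := lt_le_trans s0 st.
apply: ler_wpM2l => //; rewrite lef_pV2 ?posrE ?powR_gt0//.
by apply: ge0_ler_powR => //; rewrite nnegrE; exact: ltW.
Qed.

Lemma tracked_is_derive (V : normedModType R) (u : R -> V) (a b M : R) f (df : R -> R) :
  (forall t, a <= t -> t <= b -> is_derive t 1 f (df t)) ->
  (forall t, a <= t -> t <= b -> `|df t| <= M) ->
  tracked_by u a b f.
Proof.
move=> Df fM; apply: (@tracked_lipschitz _ _ _ _ _ _ _ M) => s t as_ st tb.
have [->|st'] := eqVneq s t; first by rewrite !subrr normr0 mulr0.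
have ts : s < t by rewrite lt_neqAle st'.
have [||c] := @MVT R f df s t ts.
- move=> z; rewrite in_itv/= => /andP[sz zt].
  by apply: Df; [exact: le_trans as_ (ltW sz)|exact: le_trans (ltW zt) tb].
- apply: continuous_in_subspaceT => z; rewrite inE/= in_itv/= => /andP[sz zt].
  by apply: (is_derive_continuous (Df z _ _)); [exact: le_trans sz|exact: le_trans tb].
rewrite in_itv/= => /andP[sc ct] ->.
rewrite normrM [`|t - s|]ger0_norm ?subr_ge0//; apply: ler_wpM2r; first by rewrite subr_ge0.
by apply: fM; [exact: le_trans as_ (ltW sc)|exact: le_trans (ltW ct) tb].
Qed.

Lemma tracked_div_powR (V : normedModType R) (u : R -> V) (a b c r : R) :
  0 < a -> 0 <= r -> 0 <= c -> tracked_by u a b (fun s => c / s `^ r).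
Proof.
move=> a0 r0 c0.
apply: (@tracked_is_derive _ u a b (r / a * (c / a `^ r)) _ (fun t => - (r / t * (c / t `^ r)))).
  by move=> t at_ tb; apply: is_derive_div_powR; exact: lt_le_trans at_.
move=> t at_ tb; have t0 := lt_le_trans a0 at_.
have rt0 s : 0 < s -> 0 <= c / s `^ r by move=> ?; rewrite divr_ge0// powR_ge0.
rewrite normrN ger0_norm; last by rewrite mulr_ge0 ?rt0// divr_ge0// ltW.
apply: ler_pM => //; first by rewrite divr_ge0// ltW.
- exact: rt0.
- by apply: ler_wpM2l => //; rewrite lef_pV2 ?posrE.
- exact: div_powR_nonincreasing.
Qed.

Lemma continuous_bounded_fun_on (W : normedModType R) (u : R -> W) (a b : R) :
  a <= b -> {within `[a, b], continuous u} -> bounded_fun_on a b u.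
Proof.
move=> ab cu.
have cn : {within `[a, b], continuous (fun t => `|u t|)}.
  by move=> z; apply: cvg_norm; exact: cu.
have [c _ hc] := EVT_max ab cn.
by exists `|u c| => t at_ tb; apply: hc; rewrite in_itv/= at_.
Qed.

(** The base point [b] stays away from [a], near which [f] may fail to be integrable. *)
Lemma primitive_exists f (a b : R) : a < b ->
  (forall t, a < t -> {for t, continuous f}) ->
  exists F : R -> R, forall t, b < t -> is_derive t 1 F (f t).
Proof.
move=> ab cf.
exists (fun x => \int[@lebesgue_measure R]_(t in [set` `[b, x]]) f t) => t bt.
have := @continuous_FTC1_closed R f b t (t + 1).
have t1 : t < t + 1 by rewrite ltrDl.
move=> /(_ t1); case => //.
- apply: continuous_compact_integrable; first exact: segment_compact.
  apply: continuous_in_subspaceT => z; rewrite inE/= in_itv/= => /andP[bz _].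
  by apply: cf; exact: lt_le_trans bz.
- by apply: cf; exact: lt_trans bt.
move=> D E; split; first exact: D.
by rewrite -derive1E.
Qed.

End real_derivatives.

(** * Projection onto a shifted convex hull, and auxiliary estimates *)

(** First-order optimality: moving [y] towards the vertex [v i + k] cannot shorten it. The
    multipliers are used for the second-order inequality, the vertex inequalities for the decay of
    each energy. *)
Lemma min_norm_conv_hull (R : realType) (H : normedModType R)
    (inner : H -> H -> R) (m : nat) (v : 'I_m -> H) (k y : H) :
  is_inner_product inner ->
  is_min_norm [set c + k | c in conv_hull v] y ->
  (exists l : 'I_m -> R, [/\ forall i, 0 <= l i, \sum_(i < m) l i = 1 &
     y = \sum_(i < m) l i *: v i + k]) /\
  forall i, `|y| ^+ 2 <= inner y (v i + k).
Proof.
move=> ip [[_ [l [l0 l1] <-] yE] ymin]; split; first by exists l.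
move=> i; set d := v i + k - y.
have key (s : R) : 0 <= s -> s <= 1 -> 0 <= s * (2 * inner y d + s * `|d| ^+ 2).
  move=> s0 s1.
  have hull : [set c + k | c in conv_hull v] (y + s *: d).
    exists (\sum_(j < m) ((1 - s) * l j + s * (j == i)%:R) *: v j); last first.
      have -> : \sum_(j < m) ((1 - s) * l j + s * (j == i)%:R) *: v j =
                (1 - s) *: \sum_(j < m) l j *: v j + s *: v i.
        rewrite scaler_sumr.
        have -> : s *: v i = \sum_(j < m) (s * (j == i)%:R) *: v j.
          rewrite (bigD1 i)//= eqxx mulr1 big1 ?addr0// => j /negbTE ->.
          by rewrite mulr0 scale0r.
        by rewrite -big_split/=; apply: eq_bigr => j _; rewrite scalerDl scalerA.
      rewrite /d -yE; set A := \sum_(j < m) _.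
      have -> : v i + k - (A + k) = v i - A by rewrite opprD addrACA subrr addr0.
      rewrite scalerBl scale1r scalerBr -!addrA; congr (A + _).
      by rewrite addrC -addrA addrCA.
    exists (fun j => (1 - s) * l j + s * (j == i)%:R) => //; split.
      by move=> j; rewrite addr_ge0// mulr_ge0// ?subr_ge0.
    rewrite big_split/= -!mulr_sumr l1 (bigD1 i)//= eqxx big1 ?addr0 ?mulr1 ?subrK//.
    by move=> j /negbTE ->.
  have := ymin _ hull; rewrite -(@ler_pXn2r _ 2) ?nnegrE//.
  rewrite (normD_sqr ip) (innerZr ip) normrZ exprMn real_normK ?num_real//.
  by set Y := `|y|; lra.
have : 0 <= inner y d.
  rewrite leNgt; apply/negP => yd.
  have D0 : 0 <= `|d| ^+ 2 by exact: sqr_ge0.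
  pose s := Num.min 1 (- inner y d / (1 + `|d| ^+ 2)).
  have s0 : 0 < s.
    by rewrite lt_min ltr01/= divr_gt0 ?oppr_gt0// ltr_pwDl.
  have s1 : s <= 1 by rewrite ge_min lexx.
  have sd : s * (1 + `|d| ^+ 2) <= - inner y d.
    by rewrite -ler_pdivlMr ?ltr_pwDl// ge_min lexx orbT.
  have := key s (ltW s0) s1; rewrite pmulr_rge0//.
  have : s * (1 + `|d| ^+ 2) = s + s * `|d| ^+ 2 by ring.
  lra.
by rewrite /d (innerBr ip) (inner_sqr ip) subr_ge0.
Qed.

Lemma abs_cont_onW (R : realType) (V : normedModType R) (u : R -> V) (a a' b : R) :
  a <= a' -> abs_cont_on a b u -> abs_cont_on a' b u.
Proof.
move=> aa' ac e e0; have [d d0 acd] := ac e e0; exists d => // n s t st.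
by apply: acd => k; have [a's [-> ->]] := st k; split=> //; exact: le_trans a's.
Qed.

(* The choice of [eta] and [e] in [residual_cvg]: the three errors are at most
   [D / 4], [D / 8] and [D / 4]. *)
Lemma anchor_error_le (R : realType) (D s K B : R) :
  0 <= D -> 0 <= s -> s <= 1 -> 0 <= K -> s * (16 * (1 + K)) <= D -> 0 <= B ->
  2 * (1 + s) * (D / 16) + 2 * s * K
    + 4 * (D / (16 * (2 * B + 1))) * (B * (1 + s) + 1) <= D.
Proof.
move=> D0 s0 s1 K0 sD B0.
have k1 : s * D <= D by rewrite -[leRHS]mul1r; apply: ler_wpM2r.
have k2 : 0 <= s * K by exact: mulr_ge0.
have B1 : 0 < 2 * B + 1 by rewrite ltr_wpDl// mulr_ge0.
have k3 : 4 * (D / (16 * (2 * B + 1))) * (B * (1 + s) + 1) <= D / 4.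
  have -> : D / 4 = 4 * (D / (16 * (2 * B + 1))) * (2 * B + 1).
    by field; rewrite gt_eqF.
  apply: ler_wpM2l; first by rewrite mulr_ge0// divr_ge0// mulr_ge0// ltW.
  by rewrite lerD2r [leRHS]mulrC; apply: ler_wpM2l => //; lra.
lra.
Qed.

(** * Trajectories *)

Section trajectory.
Context {R : realType} {H : normedModType R} (inner : H -> H -> R).
Context (m : nat) (f : 'I_m -> H -> R) (g : 'I_m -> H -> H).
Context (t0 alpha beta q p M : R) (x xd xdd : R -> H).
Hypothesis ip : is_inner_product inner.
Hypothesis m_gt0 : (0 < m)%N.
Hypothesis cf : forall i, convex_fun (f i).
Hypothesis fg : forall i, is_gradient inner (f i) (g i).
Hypothesis lg : forall i, lipschitz_fun (g i).
Hypothesis t0_gt0 : 0 < t0.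
Hypothesis alpha_gt0 : 0 < alpha.
Hypothesis beta_gt0 : 0 < beta.
Hypothesis q_gt0 : 0 < q.
Hypothesis q_lt1 : q < 1.
Hypothesis p_gt0 : 0 < p.
Hypothesis p_lt : p < q + 1.
Hypothesis Dx : forall t, t0 < t -> is_derive t 1 x (xd t).
Hypothesis cxd : {within `[t0, +oo[, continuous xd}.
Hypothesis acxd : forall T, t0 <= T -> abs_cont_on t0 T xd.
Hypothesis Dxd :
  {ae (@lebesgue_measure R), forall t, t0 < t -> is_derive t 1 xd (xdd t)}.
Hypothesis projE :
  {ae (@lebesgue_measure R), forall t, t0 <= t ->
     is_min_norm
       [set c + (beta / t `^ p) *: x t + xdd t | c in conv_hull (fun i => g i (x t))]
       (- (alpha / t `^ q) *: xd t)}.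
Hypothesis xM : forall t, t0 <= t -> `|x t| <= M.

Let gam t := alpha / t `^ q.
Let eps t := beta / t `^ p.

Let good (t : R) := is_derive t 1 xd (xdd t) /\
  is_min_norm [set c + (eps t *: x t + xdd t) | c in conv_hull (fun i => g i (x t))]
    (- (gam t *: xd t)).

Let ae_filter : Filter (nbhs (almost_everywhere (@lebesgue_measure R))).
Proof. exact: (ae_filter_ringOfSetsType (@lebesgue_measure R)). Qed.

Let good_ae : {ae (@lebesgue_measure R), forall t, t0 < t -> good t}.
Proof.
have FF := ae_filter; near=> t => tt; split; first by move: tt; near: t; exact: Dxd.
have := ltW tt; rewrite -scaleNr.
have -> : (fun c => c + (eps t *: x t + xdd t)) = (fun c => c + eps t *: x t + xdd t).
  by apply/funext => c; rewrite addrA.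
by near: t; exact: projE.
Unshelve. all: by end_near. Qed.

Let pos t : t0 < t -> 0 < t. Proof. exact: lt_trans. Qed.

Let gam_gt0 t : t0 < t -> 0 < gam t.
Proof. by move=> /pos ?; rewrite divr_gt0// powR_gt0. Qed.

Let eps_gt0 t : t0 < t -> 0 < eps t.
Proof. by move=> /pos ?; rewrite divr_gt0// powR_gt0. Qed.

Let xd_cont t : t0 < t -> {for t, continuous xd}.
Proof.
move=> tt; have /continuous_within_itvcyP[h _] := cxd.
by apply: h; rewrite in_itv/= tt.
Qed.

Let xd_bounded a b : t0 < a -> a <= b -> bounded_fun_on a b xd.
Proof.
move=> ta ab; apply: continuous_bounded_fun_on => //.
apply: continuous_in_subspaceT => z; rewrite inE/= in_itv/= => /andP[az _].
by apply: xd_cont; exact: lt_le_trans az.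
Qed.

(** Every integration involving [xdd] passes through this statement: derivatives are required only
    at good times. *)
Let good_nonincreasing (G : R -> R) a b : t0 < a -> a <= b ->
  tracked_by xd a b G ->
  (forall t, a < t < b -> good t -> exists2 d, is_derive t 1 G d & d <= 0) ->
  G b <= G a.
Proof.
move=> ta ab [K GK] DG.
apply: (@abs_cont_ae_nonincreasing R H xd G a b K ab) => //.
  by apply: abs_cont_onW (ltW ta) _; apply: acxd; exact: le_trans (ltW ta) ab.
have FF := ae_filter; near=> t => tab; apply: DG => //.
have : t0 < t by case/andP: tab => at_ _; exact: lt_trans at_.
by near: t; exact: good_ae.
Unshelve. all: by end_near.
Qed.

(** The mean value theorem is scalar, so it is applied to the component of [x] along the chord
    [x t - x s]. *)
Let tracked_x a b : t0 < a -> a <= b -> tracked_by xd a b x.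
Proof.
move=> ta ab; have [B hB] := xd_bounded ta ab.
have B0 : 0 <= B by apply: le_trans (hB a (lexx _) ab).
apply: (@tracked_lipschitz _ _ _ _ _ _ _ B) => s t as_ st tb.
have [->|xts] := eqVneq (x t) (x s).
  by rewrite subrr normr0 mulr_ge0// subr_ge0.
have st' : s < t.
  by rewrite lt_neqAle st andbT; apply: contraNneq xts => ->.
pose phi r := inner (x r) (x t - x s).
have Dphi r : t0 < r -> is_derive r 1 phi (inner (xd r) (x t - x s)).
  move=> tr; apply: is_derive_eq.
    exact: (is_derive_inner ip (Dx tr) (is_derive_cst (x t - x s) r 1)).
  by rewrite (innerC ip _ 0) (inner0l ip) addr0.
have [||c] := @MVT R phi (fun r => inner (xd r) (x t - x s)) s t st'.
- move=> z; rewrite in_itv/= => /andP[sz _]; apply: Dphi.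
  by apply: lt_trans sz; exact: lt_le_trans as_.
- apply: continuous_in_subspaceT => z; rewrite inE/= in_itv/= => /andP[sz _].
  apply: (is_derive_continuous (Dphi z _)).
  by apply: lt_le_trans sz; exact: lt_le_trans as_.
rewrite in_itv/= => /andP[sc ct]; rewrite /phi -(innerBl ip) (inner_sqr ip) => E.
have n0 : 0 < `|x t - x s| by rewrite normr_gt0 subr_eq0.
rewrite -(ler_pM2l n0) -expr2 E.
apply: le_trans (ler_norm _) _; rewrite normrM (ger0_norm (_ : 0 <= t - s)) ?subr_ge0//.
rewrite mulrA; apply: ler_wpM2r; first by rewrite subr_ge0.
apply: le_trans (cauchy_schwarz ip _ _) _; rewrite mulrC; apply: ler_wpM2l => //.
by apply: hB; [exact: le_trans as_ (ltW sc)|exact: le_trans (ltW ct) tb].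
Qed.

(** The gradient inequalities at the two end points bound the increment from both sides, and the
    gradients stay bounded along [x] because they are Lipschitz. *)
Let tracked_f i a b : t0 < a -> a <= b -> tracked_by xd a b (f i \o x).
Proof.
move=> ta ab; have [K hK] := tracked_x ta ab.
have [L hL] := lg i.
have tg : tracked_by xd a b (g i \o x).
  exists (`|L| * K) => s t as_ st tb; apply: le_trans (hL _ _) _.
  rewrite -mulrA; apply: le_trans (_ : `|L| * `|x t - x s| <= _).
    by apply: ler_wpM2r => //; exact: ler_norm.
  by apply: ler_wpM2l => //; exact: hK.
have [B hB] := tracked_bounded (xd_bounded ta ab) tg.
have B0 : 0 <= B by apply: le_trans (hB a (lexx _) ab).
exists (B * K) => s t as_ st tb; rewrite -mulrA.
apply: le_trans (_ : B * `|x t - x s| <= _); last first.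
  by apply: ler_wpM2l => //; exact: hK.
have h1 := convex_gradient_ineq (x s) (x t) (@cf i) (@fg i).
have h2 := convex_gradient_ineq (x t) (x s) (@cf i) (@fg i).
have n1 : `|inner (g i (x s)) (x t - x s)| <= B * `|x t - x s|.
  apply: le_trans (cauchy_schwarz ip _ _) _; apply: ler_wpM2r => //.
  by apply: hB => //; exact: le_trans tb.
have n2 : `|inner (g i (x t)) (x s - x t)| <= B * `|x t - x s|.
  rewrite [`|x t - _|]distrC.
  apply: le_trans (cauchy_schwarz ip _ _) _; apply: ler_wpM2r => //.
  by apply: hB => //; exact: le_trans st.
move: n1 n2; rewrite !ler_norml => /andP[n1 _] /andP[n2 _].
by apply/andP; split; rewrite /=; lra.
Qed.

Let gtrack_inner (u v : R -> H) a b : t0 < a -> a <= b ->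
  tracked_by xd a b u -> tracked_by xd a b v ->
  tracked_by xd a b (fun t => inner (u t) (v t)).
Proof.
move=> ta ab; apply: (@tracked_bilinear R H xd a b (xd_bounded ta ab) H H R).
- by move=> *; rewrite (innerBl ip).
- by move=> *; rewrite (innerBr ip).
- exact: cauchy_schwarz.
Qed.

Let gtrack_norm_sqr (u : R -> H) a b : t0 < a -> a <= b ->
  tracked_by xd a b u -> tracked_by xd a b (fun t => `|u t| ^+ 2).
Proof.
move=> ta ab tu.
have -> : (fun t => `|u t| ^+ 2) = (fun t => inner (u t) (u t)).
  by apply/funext => t; rewrite (inner_sqr ip).
exact: gtrack_inner.
Qed.

Let gtrackM (u v : R -> R) a b : t0 < a -> a <= b ->
  tracked_by xd a b u -> tracked_by xd a b v ->
  tracked_by xd a b (fun t => u t * v t).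
Proof. by move=> ta ab; apply: trackedM; exact: xd_bounded. Qed.

(** * Energies and the second-order inequality *)

Let energy i t := f i (x t) + 2^-1 * (eps t * `|x t| ^+ 2) + 2^-1 * `|xd t| ^+ 2.

Let dissip t := gam t * `|xd t| ^+ 2 + 2^-1 * (p / t * eps t * `|x t| ^+ 2).

Let tracked_energy i a b : t0 < a -> a <= b -> tracked_by xd a b (energy i).
Proof.
move=> ta ab; apply: trackedD; first apply: trackedD; first exact: tracked_f.
  apply: gtrackM => //; first exact: tracked_cst.
  apply: gtrackM => //; last by apply: gtrack_norm_sqr => //; exact: tracked_x.
  by apply: tracked_div_powR; [exact: pos|exact: ltW|exact: ltW].
apply: gtrackM => //; first exact: tracked_cst.
by apply: gtrack_norm_sqr => //; exact: tracked_self.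
Qed.

(** The vertex inequality for [- (gam t *: xd t)], divided by [gam t], bounds the inner product of
    [xd t] with [g i (x t) + (eps t *: x t + xdd t)] for every [i] at once. The second part of
    [dissip] is the decay of [eps]. *)
Let energy_derive i t : t0 < t -> good t ->
  exists2 d, is_derive t 1 (energy i) d & d <= - dissip t.
Proof.
move=> tt [Dv /(min_norm_conv_hull ip)[_ /(_ i) proj]].
have tp := pos tt; have g0 := gam_gt0 tt.
have D1 := is_derive_gradient (@fg i) (Dx tt).
have D2 := is_derive_fun_mul (is_derive_fun_cst 2^-1 t)
  (is_derive_fun_mul (is_derive_div_powR beta p tp) (is_derive_norm_sqr ip (Dx tt))).
have D3 := is_derive_fun_mul (is_derive_fun_cst 2^-1 t) (is_derive_norm_sqr ip Dv).
apply: ex_intro2; first exact: is_derive_fun_add (is_derive_fun_add D1 D2) D3.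
move: proj; rewrite normrN normrZ exprMn real_normK ?num_real//.
rewrite (innerNl ip) (innerZl ip) => proj.
have {}proj : inner (xd t) (g i (x t) + (eps t *: x t + xdd t)) <= - (gam t * `|xd t| ^+ 2).
  by rewrite -(ler_pM2l g0); lra.
move: proj; rewrite !(innerDr ip) (innerZr ip) !(innerC ip (xd t)) /dissip /= -/(eps t).
set X := inner (g i _) _; set Y := inner (xdd t) _; set Z := inner (x t) _.
lra.
Qed.

(* The first two terms are [h'' + gam h' - |xd t|^2] for [h t = 2^-1 * |x t - z|^2]. *)
Let second_order t z k : t0 < t -> good t ->
  (forall i, k <= energy i t - f i z) ->
  inner (xdd t) (x t - z) + gam t * inner (xd t) (x t - z)
    + eps t * (2^-1 * `|x t - z| ^+ 2) + k - 2^-1 * (eps t * `|z| ^+ 2)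
  <= 2^-1 * `|xd t| ^+ 2.
Proof.
move=> tt [_ /(min_norm_conv_hull ip)[[l [l0 l1 yE]] _]] hk.
have e0 := eps_gt0 tt.
have := congr1 (inner^~ (x t - z)) yE.
rewrite (innerNl ip) (innerZl ip) !(innerDl ip) (innerZl ip) (inner_suml ip) => E.
(* The left-hand side does not depend on [i], so it may be averaged with the unknown multipliers
   [l]. *)
have : k - 2^-1 * (eps t * `|x t| ^+ 2) - 2^-1 * `|xd t| ^+ 2 <=
       \sum_(i < m) l i * inner (g i (x t)) (x t - z).
  set A := (X in X <= _); rewrite -[A]mul1r -l1 mulr_suml; apply: ler_sum => i _.
  apply: ler_wpM2l; first exact: l0.
  have := convex_gradient_ineq (x t) z (@cf i) (@fg i).
  rewrite !(innerBr ip); have := hk i; rewrite /energy /A; lra.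
move: E; set S := \sum_(i < m) _.
rewrite (normB_sqr ip) !(innerBr ip) (inner_sqr ip).
lra.
Qed.

Let potential_dissip_ge0 t : t0 < t -> 0 <= 2^-1 * (p / t * eps t * `|x t| ^+ 2).
Proof.
move=> tt; have h1 : 0 <= p / t by rewrite divr_ge0// ltW// pos.
have h2 := mulr_ge0 (mulr_ge0 h1 (ltW (eps_gt0 tt))) (sqr_ge0 `|x t|).
by apply: mulr_ge0 => //; rewrite invr_ge0.
Qed.

Let dissip_ge0 t : t0 < t -> 0 <= dissip t.
Proof.
move=> tt; have tp := pos tt; rewrite addr_ge0//.
  by rewrite mulr_ge0 ?sqr_ge0// ltW// gam_gt0.
exact: potential_dissip_ge0.
Qed.

Let dissip_cont t : t0 < t -> {for t, continuous dissip}.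
Proof.
move=> tt; have tp := pos tt.
have cn (V : normedModType R) (u : R -> V) : {for t, continuous u} ->
    {for t, continuous (fun s => `|u s| ^+ 2)}.
  move=> cu; have -> : (fun s => `|u s| ^+ 2) = (fun s => `|u s| * `|u s|).
    by apply/funext => s; rewrite expr2.
  by apply: cvgM; apply: cvg_norm.
have ce (c r : R) : {for t, continuous (fun s => c / s `^ r)}.
  exact: is_derive_continuous (is_derive_div_powR c r tp).
apply: cvgD; apply: cvgM.
- exact: ce.
- by apply: cn; exact: xd_cont.
- exact: cvg_cst.
- apply: cvgM; last by apply: cn; exact: is_derive_continuous (Dx tt).
  apply: cvgM; last exact: ce.
  by apply: cvgM; [exact: cvg_cst|apply: cvgV => //; rewrite gt_eqF].
Qed.

(** * Limits of the energies *)

Let t1 := t0 + 2.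

Let t1_gt t : t1 <= t -> t0 < t.
Proof. by rewrite /t1; lra. Qed.

Let tracked_primitive (F : R -> R) (k a b : R) : t1 <= a -> a <= b ->
  (forall t, t1 <= t -> is_derive t 1 F (k * dissip t)) -> tracked_by xd a b F.
Proof.
move=> ta ab DF.
have [B hB] : bounded_fun_on a b (fun t => k * dissip t).
  apply: continuous_bounded_fun_on => //.
  apply: continuous_in_subspaceT => z; rewrite inE/= in_itv/= => /andP[az _].
  apply: cvgM; first exact: cvg_cst.
  by apply: dissip_cont; apply: t1_gt; exact: le_trans az.
apply: (tracked_is_derive _ _ hB) => t at_ tb.
by apply: DF; exact: le_trans at_.
Qed.

(** Each [f i] lies above its tangent at [x t1], which is bounded below along a bounded
    trajectory. *)
Let energy_lower : exists c, forall i t, t0 < t -> c i <= energy i t.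
Proof.
exists (fun i => f i (x t1) - `|g i (x t1)| * (M + M)) => i t tt.
have h := convex_gradient_ineq (x t1) (x t) (@cf i) (@fg i).
have t1t : t0 <= t1 by rewrite /t1; lra.
have : `|inner (g i (x t1)) (x t - x t1)| <= `|g i (x t1)| * (M + M).
  apply: le_trans (cauchy_schwarz ip _ _) _; apply: ler_wpM2l => //.
  apply: le_trans (ler_normB _ _) _; apply: lerD; apply: xM => //.
  exact: ltW.
rewrite ler_norml => /andP[h2 _].
have h3 : 0 <= eps t * `|x t| ^+ 2 by rewrite mulr_ge0 ?sqr_ge0// ltW// eps_gt0.
have h4 : 0 <= `|xd t| ^+ 2 by exact: sqr_ge0.
rewrite /energy; lra.
Qed.

(* [J t] is the total dissipation of the energies after time [t], and [w] is the
   limit of the energies. *)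
Let residual_dissipation : exists (J : R -> R) (w : 'I_m -> R),
  [/\ forall t, t1 <= t -> is_derive t 1 J (- dissip t),
      forall t, t1 <= t -> 0 <= J t,
      forall s t, t1 <= s -> s <= t -> J t <= J s,
      forall e, 0 < e -> exists T : R, forall t, T <= t -> J t <= e &
      forall i s t, t1 <= s -> s <= t -> J s - J t <= energy i s - energy i t] /\
  [/\ forall i t, t1 <= t -> w i + J t <= energy i t &
      forall e, 0 < e -> exists T : R, forall i t, T <= t -> energy i t <= w i + e].
Proof.
(* The primitive of [dissip] is based at [t0 + 1], off the excluded [t0], and is differentiable
   strictly beyond; hence the choice of [t1] as [t0 + 2]. *)
have t01 : t0 < t0 + 1 by lra.
have [Phi DPhi'] := primitive_exists t01 dissip_cont.
have DPhi t : t1 <= t -> is_derive t 1 Phi (dissip t).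
  by move=> tt; apply: DPhi'; rewrite /t1 in tt; lra.
have tPhi a b : t1 <= a -> a <= b -> tracked_by xd a b Phi.
  move=> ta ab; apply: (@tracked_primitive _ 1) => // t tt.
  by rewrite mul1r; exact: DPhi.
have EPhi i s t : t1 <= s -> s <= t -> energy i t + Phi t <= energy i s + Phi s.
  move=> ts st; apply: (@good_nonincreasing (fun z => energy i z + Phi z) s t) => //; first exact: t1_gt.
    by apply: trackedD; [apply: tracked_energy => //; exact: t1_gt|exact: tPhi].
  move=> z /andP[sz zt] gz; have tz : t1 <= z by exact: le_trans (ltW sz).
  have [d Dd dle] := energy_derive i (t1_gt tz) gz.
  by exists (d + dissip z); [exact: is_derive_fun_add Dd (DPhi z tz)|lra].
have mPhi s t : t1 <= s -> s <= t -> Phi s <= Phi t.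
  move=> ts st; rewrite -lerN2.
  apply: (@good_nonincreasing (fun z => - Phi z) s t) => //; first exact: t1_gt.
    by apply: trackedN; exact: tPhi.
  move=> z /andP[sz zt] gz; have tz : t1 <= z by exact: le_trans (ltW sz).
  exists (- dissip z); first exact: is_derive_fun_opp (DPhi z tz).
  by rewrite oppr_le0; apply: dissip_ge0; exact: t1_gt.
have [c hc] := energy_lower.
pose A := [set Phi t | t in [set t | t1 <= t]].
have uA : ubound A (energy (Ordinal m_gt0) t1 + Phi t1 - c (Ordinal m_gt0)).
  move=> _ [t tt <-]; have := EPhi (Ordinal m_gt0) _ _ (lexx t1) tt.
  by have := hc (Ordinal m_gt0) t (t1_gt tt); lra.
have sA : has_sup A by split; [exists (Phi t1), t1 => //=|exists (energy (Ordinal m_gt0) t1 + Phi t1 - c (Ordinal m_gt0))].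
pose B i := [set energy i t + Phi t | t in [set t | t1 <= t]].
have iB i : has_inf (B i).
  split; first by exists (energy i t1 + Phi t1), t1 => //=.
  exists (c i + Phi t1) => _ [t tt <-]; apply: lerD; last exact: mPhi.
  exact: hc (t1_gt tt).
have PhiA t : t1 <= t -> Phi t <= sup A by move=> tt; apply: (ub_le_sup sA.2); exists t.
have PhiB i t : t1 <= t -> inf (B i) <= energy i t + Phi t.
  by move=> tt; apply: (ge_inf (iB i).2); exists t.
have limPhi e : 0 < e -> exists2 T : R, t1 <= T & forall t, T <= t -> sup A - Phi t <= e.
  move=> e0; have [_ [T tT <-] hT] := sup_adherent e0 sA.
  by exists T => // t Tt; have := mPhi _ _ tT Tt; lra.
(* [Phi] increases to [sup A] and [energy i + Phi] decreases to [inf (B i)]; the difference is the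
   limit of the energy. *)
exists (fun t => sup A - Phi t), (fun i => inf (B i) - sup A); split; split.
- move=> t tt; apply: is_derive_eq.
    exact: is_derive_fun_add (is_derive_fun_cst (sup A) t) (is_derive_fun_opp (DPhi t tt)).
  by rewrite add0r.
- by move=> t tt; rewrite subr_ge0; exact: PhiA.
- by move=> s t ts st; have := mPhi s t ts st; lra.
- by move=> e e0; have [T _ hT] := limPhi e e0; exists T.
- by move=> i s t ts st; have := EPhi i s t ts st; lra.
- by move=> i t tt; have := PhiB i t tt; lra.
move=> e e0; have e2 : 0 < e / 2 by rewrite divr_gt0.
have [T tT hT] := limPhi _ e2.
have lim i : exists T' : R, t1 <= T' /\ forall t, T' <= t -> energy i t + Phi t <= inf (B i) + e / 2.
  have [_ [T' tT' <-] hT'] := inf_adherent e2 (iB i).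
  exists T'; split=> // t T't; apply: le_trans (ltW hT'); exact: EPhi.
have [S hS] := choice lim.
exists (T + \sum_(i < m) `|S i|) => i t Tt.
have SiT : S i <= \sum_(i < m) `|S i|.
  apply: le_trans (ler_norm _) _; rewrite (bigD1 i)//= lerDl.
  by apply: sumr_ge0.
have T0 : 0 <= T by apply: le_trans tT; rewrite addr_ge0// ltW.
have S0 : 0 <= \sum_(i < m) `|S i| by apply: sumr_ge0.
have := (hS i).2 t; have := hT t.
have -> : T <= t by lra.
have -> : S i <= t by lra.
move=> /(_ isT) h1 /(_ isT) h2; lra.
Qed.

(** * Window estimates and convergence *)

Section residual.
Context (J : R -> R) (w : 'I_m -> R).
Hypothesis DJ : forall t, t1 <= t -> is_derive t 1 J (- dissip t).
Hypothesis J_ge0 : forall t, t1 <= t -> 0 <= J t.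
Hypothesis J_le : forall s t, t1 <= s -> s <= t -> J t <= J s.
Hypothesis J_small : forall e, 0 < e -> exists T : R, forall t, T <= t -> J t <= e.
Hypothesis J_energy : forall i s t, t1 <= s -> s <= t -> J s - J t <= energy i s - energy i t.
Hypothesis w_energy : forall i t, t1 <= t -> w i + J t <= energy i t.
Hypothesis energy_w : forall e, 0 < e -> exists T : R, forall i t, T <= t -> energy i t <= w i + e.

(* The weight [(s - a) * (b - s)] vanishes at both ends, so that no bound on the
   derivative of [h] is needed; the dissipation absorbs the kinetic energy. *)
Let window_bound (h hd : R -> R) (psi C a b : R) : t1 <= a -> a < b ->
  (forall t, a <= t -> t <= b -> is_derive t 1 h (hd t)) ->
  tracked_by xd a b h -> tracked_by xd a b hd ->
  (forall t, a < t < b -> good t -> exists2 hdd, is_derive t 1 hd hdd &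
     hdd + gam t * hd t <= 3 * `|xd t| ^+ 2 - psi) ->
  (forall t, a <= t -> t <= b -> 0 <= h t <= C) ->
  psi * ((b - a) ^+ 3 / 6) <=
  3 * (b - a) ^+ 2 / (4 * gam b) * (J a - J b) + 2 * C * (b - a)
    + (b - a) ^+ 2 * (gam a * C).
Proof.
move=> ta ab Dh trh trhd Dhd hC.
have a0 := t1_gt ta; have b0 : t0 < b by exact: lt_trans ab.
have gb0 := gam_gt0 b0; have ga0 := gam_gt0 a0.
set L := b - a; have L0 : 0 < L by rewrite subr_gt0.
(* The weight is at most [L ^+ 2 / 4], so [B * gam b] is three times its maximum and [B * dissip]
   absorbs the kinetic term. *)
set B := 3 * L ^+ 2 / (4 * gam b).
have B0 : 0 < B by rewrite divr_gt0// mulr_gt0// exprn_gt0.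
(* The first two terms come from integrating the weight times h'' by parts twice. The polynomial
   after [psi] is the primitive of the weight, with total [L ^+ 3 / 6]. The last term pays for
   [2 * h] and for the derivative of the weight times [gam * h]; the derivative of [gam] has a
   favourable sign. *)
pose G (s : R) : R := (s - a) * (b - s) * hd s - (a + b - 2 * s) * h s
  + (s - a) * (b - s) * (gam s * h s) + B * J s
  + psi * (L / 2 * ((s - a) * (s - a)) - 3^-1 * ((s - a) * ((s - a) * (s - a))))
  - (2 * C + L * (gam a * C)) * (s - a).
have tsa : tracked_by xd a b (fun s => s - a).
  by apply: trackedD; [exact: tracked_id|exact: tracked_cst].
have tbs : tracked_by xd a b (fun s => b - s).
  by apply: trackedB; [exact: tracked_cst|exact: tracked_id].
have tM (u v : R -> R) : tracked_by xd a b u -> tracked_by xd a b v ->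
    tracked_by xd a b (fun t => u t * v t).
  by apply: gtrackM => //; exact: ltW.
have tC (k : R) : tracked_by xd a b (fun=> k) by exact: tracked_cst.
have tG : tracked_by xd a b G.
  apply: trackedB; last exact: tM.
  apply: trackedD; last first.
    apply: (tM _ _ (tC psi)); apply: trackedB; apply: (tM _ _ (tC _)); first exact: tM.
    by apply: (@tM _ _) => //; exact: tM.
  apply: trackedD; last first.
    by apply: (tM _ _ (tC B)); apply: (@tracked_primitive _ (-1)) => //; [exact: ltW|move=> t tt; rewrite mulN1r; exact: DJ].
  apply: trackedD; last first.
    apply: (@tM _ _); first exact: tM.
    by apply: (@tM _ _) => //; apply: tracked_div_powR; [exact: pos|exact: ltW|exact: ltW].
  apply: trackedB; first by apply: (@tM _ _) => //; exact: tM.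
  apply: (@tM _ _) => //; apply: trackedB; first exact: tC.
  by apply: (tM _ _ (tC 2)); exact: tracked_id.
have GG : G b <= G a.
  apply: (@good_nonincreasing G a b) => //; first exact: ltW.
  move=> t /[dup] tab /andP[at_ tb] gt.
  have [hdd Dd dle] := Dhd t tab gt.
  have tt : t1 <= t by exact: le_trans (ltW at_).
  have tp := pos (t1_gt tt).
  have Dsa : is_derive t 1 (fun s => s - a) (1 + - 0).
    exact: is_derive_fun_add (is_derive_fun_id t) (is_derive_fun_opp (is_derive_fun_cst a t)).
  have Dbs : is_derive t 1 (fun s => b - s) (0 + - 1).
    exact: is_derive_fun_add (is_derive_fun_cst b t) (is_derive_fun_opp (is_derive_fun_id t)).
  have Dth := is_derive_fun_mul Dsa Dbs.
  have Dht := Dh t (ltW at_) (ltW tb).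
  have D1 := is_derive_fun_mul Dth Dd.
  have D2 := is_derive_fun_opp (is_derive_fun_mul (is_derive_fun_add (is_derive_fun_cst (a + b) t)
     (is_derive_fun_opp (is_derive_fun_mul (is_derive_fun_cst 2 t) (is_derive_fun_id t)))) Dht).
  have D3 := is_derive_fun_mul Dth (is_derive_fun_mul (is_derive_div_powR alpha q tp) Dht).
  have D4 := is_derive_fun_mul (is_derive_fun_cst B t) (DJ tt).
  have D5 := is_derive_fun_mul (is_derive_fun_cst psi t) (is_derive_fun_add
    (is_derive_fun_mul (is_derive_fun_cst (L / 2) t) (is_derive_fun_mul Dsa Dsa))
    (is_derive_fun_opp (is_derive_fun_mul (is_derive_fun_cst 3^-1 t)
      (is_derive_fun_mul Dsa (is_derive_fun_mul Dsa Dsa))))).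
  have D6 := is_derive_fun_opp (is_derive_fun_mul (is_derive_fun_cst (2 * C + L * (gam a * C)) t) Dsa).
  apply: ex_intro2.
    exact: is_derive_fun_add (is_derive_fun_add (is_derive_fun_add (is_derive_fun_add (is_derive_fun_add D1 D2) D3) D4) D5) D6.
  have gt0 := gam_gt0 (t1_gt tt).
  rewrite /= -/(gam t).
  have /andP[h0 hleC] := hC t (ltW at_) (ltW tb).
  have gta : gam t <= gam a by apply: div_powR_nonincreasing; [exact: ltW|exact: ltW|exact: pos|exact: ltW].
  have gbt : gam b <= gam t by apply: div_powR_nonincreasing => //; exact: ltW.
  set v2 := `|xd t| ^+ 2 in dle *.
  have v0 : 0 <= v2 by exact: sqr_ge0.
  set th := (t - a) * (b - t).
  have th0 : 0 <= th by rewrite mulr_ge0// subr_ge0 ltW.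
  have E1 : th * (hdd + gam t * hd t) <= th * (3 * v2 - psi) by apply: ler_wpM2l.
  have thL : 3 * th <= B * gam b.
    have -> : B * gam b = 3 * L ^+ 2 / 4 by rewrite /B; field; rewrite gt_eqF.
    have := sqr_ge0 (a + b - 2 * t); rewrite /th /L !expr2; lra.
  have thL' : B * gam b <= B * gam t by rewrite ler_pM2l.
  have E2 : 3 * th * v2 <= B * gam t * v2 by apply: ler_wpM2r => //; exact: le_trans thL'.
  have E3 : gam t * v2 <= dissip t.
    by rewrite /dissip lerDl; apply: potential_dissip_ge0; exact: t1_gt.
  have {}E3 : B * (gam t * v2) <= B * dissip t by rewrite ler_pM2l.
  have E4 : 0 <= th * (q / t * gam t * h t).
    apply: mulr_ge0 => //; apply: mulr_ge0 => //; apply: mulr_ge0; last exact: ltW.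
    by apply: divr_ge0; exact: ltW.
  have gh : gam t * h t <= gam a * C by apply: ler_pM => //; exact: ltW.
  have gh0 : 0 <= gam t * h t by rewrite mulr_ge0// ltW.
  have E6 : (a + b - 2 * t) * (gam t * h t) <= L * (gam a * C).
    apply: le_trans (_ : L * (gam t * h t) <= _).
      by apply: ler_wpM2r => //; rewrite /L; lra.
    by rewrite ler_pM2l.
  move: E1 E2 E3 E4 E6; rewrite /th.
  set X := L * (gam a * C); set Z := dissip t; move=> E1 E2 E3 E4 E6.
  rewrite /L; lra.
have ha := hC a (lexx _) (ltW ab); have hb := hC b (ltW ab) (lexx _).
move: GG; rewrite /G !subrr !(mul0r, mulr0, subr0, add0r).
have E7 : 0 <= L * h a by case/andP: ha => ? _; rewrite mulr_ge0// ltW.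
have E8 : 0 <= L * h b by case/andP: hb => ? _; rewrite mulr_ge0// ltW.
move: E7 E8; rewrite -/L.
have -> : a + b - 2 * a = L by rewrite /L; ring.
have -> : a + b - 2 * b = - L by rewrite /L; ring.
set X := gam a * C; set Y := B * J a; set Z := B * J b.
have -> : B * (J a - J b) = Y - Z by rewrite mulrBr.
rewrite !expr2 !exprS expr0; lra.
Qed.

(** The coefficient 3 in the kinetic term is the cost of two anchors, 3/2 for each. *)
Let windowed (h hd : R -> R) (psi C a b : R) :=
  [/\ forall t, a <= t -> t <= b -> is_derive t 1 h (hd t),
      tracked_by xd a b h, tracked_by xd a b hd,
      forall t, a < t < b -> good t -> exists2 hdd, is_derive t 1 hd hdd &
        hdd + gam t * hd t <= 3 * `|xd t| ^+ 2 - psi &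
      forall t, a <= t -> t <= b -> 0 <= h t <= C].

(** Dividing the window bound by [L ^+ 3 / 6], with [L = xi * b], leaves a kinetic term of order
    b^(q-1) relative to [J a], and boundary and friction terms of orders b^(p-2) and b^(p-q-1)
    relative to [eps b]. All three exponents are negative. The threshold does not depend on [h] or
    [psi], so an anchor may move with [b]. *)
Let window_eventually (xi C e : R) : 0 < xi -> xi < 1 -> 0 <= C -> 0 < e ->
  exists T : R, forall b, T <= b ->
    [/\ 0 < b, t1 <= (1 - xi) * b, (1 - xi) * b <= b & forall h hd psi,
      windowed h hd psi C ((1 - xi) * b) b ->
      psi <= e * J ((1 - xi) * b) + e * eps b].
Proof.
move=> xi0 xi1 C0 e0.
have xi1' : 0 < 1 - xi by lra.
have p1 : 0 < 1 - q by rewrite subr_gt0.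
have p3 : 0 < 1 + q - p by rewrite subr_gt0 addrC.
have p2 : 0 < 2 - p by lra.
(* The constants 9/2, 24 and 12 grant the kinetic term all of [e * J a] and each of the two others
   half of [e * eps b]. *)
have [T1 T11 hT1] := powR_eventually_ge (9 / 2 / (e * xi * alpha)) p1.
have [T2 T21 hT2] := powR_eventually_ge (24 * C / (e * xi ^+ 2 * beta)) p2.
have [T3 T31 hT3] := powR_eventually_ge (12 * C * alpha / (1 - xi) `^ q / (e * xi * beta)) p3.
have t1p : 0 < t1 by apply: pos; rewrite /t1 ltrDl.
exists (T1 + T2 + T3 + t1 / (1 - xi)) => b Tb.
have t1xi : 0 < t1 / (1 - xi) by rewrite divr_gt0.
have b1 : 1 <= b by lra.
have b0 : 0 < b by lra.
have ta : t1 <= (1 - xi) * b.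
  by rewrite mulrC -ler_pdivrMr//; lra.
have ab : (1 - xi) * b < b by have := mulr_gt0 xi0 b0; lra.
split=> //; first exact: ltW.
move=> h hd psi [Dh trh trhd Dhd hC].
have := window_bound ta ab Dh trh trhd Dhd hC.
set a := (1 - xi) * b.
have a0 : 0 < a by rewrite mulr_gt0.
have -> : b - a = xi * b by rewrite /a; ring.
set L := xi * b; have L0 : 0 < L by rewrite mulr_gt0.
have tb : t0 < b by apply: lt_trans ab; exact: t1_gt.
have gb0 := gam_gt0 tb; have eb0 := eps_gt0 tb.
have bq : 0 < b `^ q by exact: powR_gt0.
have bp : 0 < b `^ p by exact: powR_gt0.
have h1 : 9 / 2 <= e * (L * gam b).
  have := hT1 b; have -> : T1 <= b by lra.
  rewrite powRB ?(gt_eqF b0) ?implybT// powRr1 ?(ltW b0)//.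
  rewrite ler_pdivrMr ?mulr_gt0// => /(_ isT) /le_trans; apply.
  rewrite le_eqVlt; apply/orP; left; apply/eqP.
  by rewrite /L /gam; field; rewrite gt_eqF.
have h2 : 24 * C <= e * (L ^+ 2 * eps b).
  have := hT2 b; have -> : T2 <= b by lra.
  rewrite powRB ?(gt_eqF b0) ?implybT// (powR_mulrn 2) ?(ltW b0)//.
  rewrite ler_pdivrMr ?mulr_gt0 ?exprn_gt0// => /(_ isT) /le_trans; apply.
  rewrite le_eqVlt; apply/orP; left; apply/eqP.
  by rewrite /L /eps; field; rewrite gt_eqF.
have h3 : 12 * C * gam a <= e * (L * eps b).
  have := hT3 b; have -> : T3 <= b by lra.
  rewrite powRB ?(gt_eqF b0) ?implybT// powRD ?(gt_eqF b0) ?implybT// powRr1 ?(ltW b0)//.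
  rewrite ler_pdivrMr ?mulr_gt0// => /(_ isT) hh.
  have -> : gam a = alpha / (1 - xi) `^ q / b `^ q.
    by rewrite /gam /a powRM ?(ltW b0) ?(ltW xi1')// invfM mulrA.
  rewrite mulrA mulrA ler_pdivrMr//; apply: le_trans hh _.
  rewrite le_eqVlt; apply/orP; left; apply/eqP.
  by rewrite /L /eps; field; rewrite gt_eqF.
have Ja0 := J_ge0 ta; have Jb0 : 0 <= J b by apply: J_ge0; exact: le_trans (ltW ab).
move=> hw.
have L3 : 0 < L ^+ 3 / 6 by rewrite divr_gt0// exprn_gt0.
rewrite -(ler_pM2r L3); apply: le_trans hw _.
have k1 : 3 * L ^+ 2 / (4 * gam b) * (J a - J b) <= L ^+ 3 / 6 * (e * J a).
  apply: le_trans (_ : 3 * L ^+ 2 / (4 * gam b) * J a <= _).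
    apply: ler_wpM2l; last by rewrite gerBl.
    by rewrite divr_ge0// mulr_ge0// ?sqr_ge0// ltW.
  rewrite mulrA; apply: ler_wpM2r => //.
  rewrite ler_pdivrMr//; last exact: mulr_gt0.
  have -> : L ^+ 3 / 6 * e * (4 * gam b) = L ^+ 2 * (2 / 3) * (e * (L * gam b)) by field.
  have -> : 3 * L ^+ 2 = L ^+ 2 * (2 / 3) * (9 / 2) by field.
  by apply: ler_wpM2l => //; rewrite mulr_ge0// sqr_ge0.
have k2 : 2 * C * L <= L ^+ 3 / 6 * (e * eps b / 2).
  have -> : L ^+ 3 / 6 * (e * eps b / 2) = L / 12 * (e * (L ^+ 2 * eps b)) by field.
  have -> : 2 * C * L = L / 12 * (24 * C) by field.
  by apply: ler_wpM2l => //; rewrite divr_ge0// ltW.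
have k3 : L ^+ 2 * (gam a * C) <= L ^+ 3 / 6 * (e * eps b / 2).
  have -> : L ^+ 3 / 6 * (e * eps b / 2) = L ^+ 2 / 12 * (e * (L * eps b)) by field.
  have -> : L ^+ 2 * (gam a * C) = L ^+ 2 / 12 * (12 * C * gam a) by field.
  by apply: ler_wpM2l => //; rewrite divr_ge0// sqr_ge0.
apply: le_trans (lerD (lerD k1 k2) k3) _.
by rewrite le_eqVlt; apply/orP; left; apply/eqP; field.
Qed.

Let sqdist z t := 2^-1 * `|x t - z| ^+ 2.
Let sqdist' z t := inner (xd t) (x t - z).

Let is_derive_subx z t : t0 < t -> is_derive t 1 (fun s => x s - z) (xd t).
Proof.
move=> tt; apply: is_derive_eq.
  exact: (is_deriveB (Dx tt) (is_derive_cst z t 1)).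
by rewrite subr0.
Qed.

Let sqdist_derive z t : t0 < t -> is_derive t 1 (sqdist z) (sqdist' z t).
Proof.
move=> tt; apply: is_derive_eq.
  exact: is_derive_fun_mul (is_derive_fun_cst 2^-1 t)
    (is_derive_norm_sqr ip (is_derive_subx z tt)).
by rewrite mul0r add0r mulrA mulVf ?mul1r.
Qed.

Let sqdist'_derive z t : t0 < t -> good t ->
  is_derive t 1 (sqdist' z) (inner (xdd t) (x t - z) + `|xd t| ^+ 2).
Proof.
move=> tt [Dv _]; apply: is_derive_eq.
  exact: (is_derive_inner ip Dv (is_derive_subx z tt)).
by rewrite /= (inner_sqr ip).
Qed.

Let tracked_sqdist z a b : t0 < a -> a <= b ->
  tracked_by xd a b (sqdist z) /\ tracked_by xd a b (sqdist' z).
Proof.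
move=> ta ab.
have tz : tracked_by xd a b (fun s => x s - z).
  by apply: trackedB; [exact: tracked_x|exact: tracked_cst].
split; last by apply: gtrack_inner => //; exact: tracked_self.
by apply: gtrackM => //; [exact: tracked_cst|exact: gtrack_norm_sqr].
Qed.

Let sqdist_bound z t : t0 <= t -> 0 <= sqdist z t <= 2^-1 * (M + `|z|) ^+ 2.
Proof.
move=> tt; have n0 : 0 <= `|x t - z| by [].
have nM : `|x t - z| <= M + `|z|.
  by apply: le_trans (ler_normB _ _) _; rewrite lerD2r; exact: xM.
rewrite mulr_ge0 ?invr_ge0 ?sqr_ge0//=; apply: ler_wpM2l; first by rewrite invr_ge0.
by rewrite ler_pXn2r// nnegrE; exact: le_trans nM.
Qed.

Let second_order' z t k : t0 < t -> good t ->
  (forall i, k <= energy i t - f i z) ->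
  (inner (xdd t) (x t - z) + `|xd t| ^+ 2) + gam t * sqdist' z t <=
  3 / 2 * `|xd t| ^+ 2 - (eps t * sqdist z t + k - 2^-1 * (eps t * `|z| ^+ 2)).
Proof.
move=> tt gt hk; have := second_order tt gt hk; rewrite /sqdist /sqdist'.
set e := eps t; set c := gam t; lra.
Qed.

Let eps_le s t : t1 <= s -> s <= t -> eps t <= eps s.
Proof.
move=> ts st; apply: div_powR_nonincreasing => //; try exact: ltW.
by apply: pos; exact: t1_gt.
Qed.

Let eps_small e : 0 < e -> exists T : R, forall t, T <= t -> eps t <= e.
Proof.
move=> e0; have [T T1 hT] := powR_eventually_ge (beta / e) p_gt0.
exists T => t Tt; have tp : 0 < t by apply: lt_le_trans Tt; exact: lt_le_trans T1.
rewrite /eps ler_pdivrMr ?powR_gt0// mulrC -ler_pdivrMr//.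
exact: hT.
Qed.

(** Dropping the nonnegative distance term and freezing [eps] at the left end, where it is largest,
    leaves a bound on the gap [k] alone. It serves with a fixed gap and with [k = J b]. *)
Let one_anchor z (xi e : R) : 0 < xi -> xi < 1 -> 0 < e ->
  exists T : R, forall b, T <= b ->
    [/\ 0 < b, t1 <= (1 - xi) * b, (1 - xi) * b <= b & forall k,
      (forall i t, (1 - xi) * b <= t -> t <= b -> k <= energy i t - f i z) ->
      k <= 2^-1 * (eps ((1 - xi) * b) * `|z| ^+ 2)
           + (e * J ((1 - xi) * b) + e * eps b)].
Proof.
move=> xi0 xi1 e0.
have C0 : 0 <= 2^-1 * (M + `|z|) ^+ 2 by rewrite mulr_ge0 ?invr_ge0 ?sqr_ge0.
have [T hT] := window_eventually xi0 xi1 C0 e0.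
exists T => b Tb; have [b0 ta ab hw] := hT b Tb; split=> // k hk.
rewrite -lerBlDl; apply: (hw (sqdist z) (sqdist' z)); split.
- by move=> t at_ _; apply: sqdist_derive; apply: t1_gt; exact: le_trans at_.
- by have [] := tracked_sqdist z (t1_gt ta) ab.
- by have [] := tracked_sqdist z (t1_gt ta) ab.
- move=> t /andP[at_ tb] gt; have tt := le_trans ta (ltW at_).
  exists (inner (xdd t) (x t - z) + `|xd t| ^+ 2).
    by apply: sqdist'_derive => //; exact: t1_gt.
  have hk' i : k <= energy i t - f i z by apply: hk; exact: ltW.
  apply: le_trans (second_order' (t1_gt tt) gt hk') _.
  have /andP[s0 _] := sqdist_bound z (ltW (t1_gt tt)).
  have es0 : 0 <= eps t * sqdist z t by apply: mulr_ge0 => //; apply: ltW; exact: eps_gt0 (t1_gt tt).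
  have ee : eps t * `|z| ^+ 2 <= eps ((1 - xi) * b) * `|z| ^+ 2.
    by apply: ler_wpM2r; [exact: sqr_ge0|exact: eps_le (ltW at_)].
  have v0 := sqr_ge0 `|xd t|; lra.
- by move=> t at_ _; apply: sqdist_bound; apply: ltW; apply: t1_gt; exact: le_trans at_.
Qed.

Let w_le i t : t1 <= t -> w i <= energy i t.
Proof. by move=> tt; have := w_energy i tt; have := J_ge0 tt; lra. Qed.

(** A dominating [z] would keep a fixed gap below the energies, whereas the one-anchor bound on such
    a gap tends to 0. *)
Let limit_undominated z : ~ forall i, f i z < w i.
Proof.
move=> fz.
have [k k0 hk] : exists2 k : R, 0 < k & forall i, k <= w i - f i z.
  have [i _ hi] := @arg_minP _ R _ (Ordinal m_gt0) xpredT (fun i => w i - f i z) isT.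
  by exists (w i - f i z); [rewrite subr_gt0|move=> j; exact: hi].
have h0 : 0 < 2^-1 :> R by rewrite invr_gt0.
have h1 : 2^-1 < 1 :> R by lra.
have [T1 hT1] := one_anchor z h0 h1 ltr01.
have c0 : 0 < k / 4 / (1 + `|z| ^+ 2).
  by rewrite !divr_gt0// ltr_pwDl// sqr_ge0.
have k4 : 0 < k / 4 by rewrite divr_gt0.
have [T2 hT2] := eps_small c0.
have [T3 hT3] := J_small k4.
pose b := T1 + `|T1| + 2 * (`|T2| + `|T3|) + `|T1|.
have b1 : T1 <= b by rewrite /b; have := ler_norm (- T1); rewrite normrN; have := normr_ge0 T1; have := normr_ge0 T2; have := normr_ge0 T3; lra.
have ba : `|T2| + `|T3| <= (1 - 2^-1) * b.
  by rewrite /b; have := ler_norm (- T1); rewrite normrN; have := normr_ge0 T1; lra.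
have [b0 ta ab] := hT1 b b1.
set a := (1 - 2^-1) * b in ta ab ba *.
have aT2 : T2 <= a by have := ler_norm T2; have := normr_ge0 T3; lra.
have aT3 : T3 <= a by have := ler_norm T3; have := normr_ge0 T2; lra.
move=> /(_ k); case: (leP k) => [hle _|hlt /(_ _)].
  have h2 := hT2 a aT2; have h3 := hT3 a aT3.
  have h4 : eps b <= eps a by exact: eps_le.
  have h5 : eps a * (1 + `|z| ^+ 2) <= k / 4.
    by rewrite -ler_pdivlMr// ltr_pwDl// sqr_ge0.
  have h6 : 0 <= eps a * `|z| ^+ 2.
    by apply: mulr_ge0; [apply: ltW; exact: eps_gt0 (t1_gt ta)|exact: sqr_ge0].
  move: hle h2 h3 h4 h5 h6; set ea := eps a; set eb := eps b; lra.
suff hk' : forall i t, a <= t -> t <= b -> k <= energy i t - f i z by move=> /(_ hk').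
by move=> i t at_ tb; have := hk i; have := w_le i (le_trans ta at_); lra.
Qed.

Let eps_scale (c b : R) : 0 < c -> 0 < b -> eps (c * b) = (c `^ p)^-1 * eps b.
Proof.
move=> c0 b0; rewrite /eps powRM ?ltW// invfM.
by rewrite mulrCA.
Qed.

(** Doubling argument: the one-anchor bound on [[b / 2, b]] controls [J b] by a multiple of [eps b]
    plus a small multiple of [J (b / 2)], to which the induction hypothesis applies. *)
Let J_bounded z : (forall i, f i z <= w i) ->
  exists B T : R, [/\ 0 <= B, t1 <= T & forall t, T <= t -> J t <= B * eps t].
Proof.
move=> fz.
have h0 : 0 < 2^-1 :> R by rewrite invr_gt0.
have h1 : 2^-1 < 1 :> R by lra.
pose c : R := (2^-1 `^ p)^-1.
have c0 : 0 < c by rewrite invr_gt0 powR_gt0.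
(* Since [eps (b / 2) = c * eps b], this choice makes the constant [B] for [b / 2] contribute only
   [B / 2] at [b]. *)
have e0 : 0 < (2 * c)^-1 by rewrite invr_gt0 mulr_gt0.
have [T1 hT1] := one_anchor z h0 h1 e0.
have half : 1 - 2^-1 = 2^-1 :> R by lra.
rewrite half in hT1.
have [T1p tT T1le _] := hT1 T1 (lexx _).
have eT1 := eps_gt0 (t1_gt (le_trans tT T1le)).
pose A := c * `|z| ^+ 2 / 2 + (2 * c)^-1.
have A0 : 0 < A.
  have : 0 <= c * `|z| ^+ 2 / 2 by rewrite divr_ge0// mulr_ge0 ?sqr_ge0// ltW.
  by rewrite /A; lra.
pose Q0 := J (2^-1 * T1) / eps T1.
have Q00 : 0 <= Q0 by apply: divr_ge0; [exact: J_ge0|exact: ltW].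
(* [Q0] settles the initial window [[T1 / 2, T1]], and [2 * A + Q0] is stable under the recursion
   [B -> A + B / 2]. *)
exists (2 * A + Q0), (2^-1 * T1); split=> //; first lra.
have claim n t : 2^-1 * T1 <= t -> t <= 2 ^+ n * T1 -> J t <= (2 * A + Q0) * eps t.
  elim: n t => [|n IH] t Tt tn.
    rewrite expr0 mul1r in tn.
    apply: le_trans (J_le tT Tt) _.
    have -> : J (2^-1 * T1) = Q0 * eps T1 by rewrite divfK// gt_eqF.
    have et : eps T1 <= eps t by apply: eps_le => //; exact: le_trans Tt.
    apply: ler_pM => //; [exact: ltW|lra].
  have [tT1|T1t] := leP t T1.
    apply: IH => //; apply: le_trans tT1 _; apply: ler_peMl; first exact: ltW.
    by rewrite exprn_ege1// ler1n.
  have [tp ta tle hk] := hT1 t (ltW T1t).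
  have fzJ i s : 2^-1 * t <= s -> s <= t -> J t <= energy i s - f i z.
    move=> as_ st; have ts := le_trans ta as_.
    have := J_le ts st; have := w_energy i ts; have := fz i; lra.
  apply: le_trans (hk _ fzJ) _.
  have tn2 : 2^-1 * t <= 2 ^+ n * T1 by rewrite exprS in tn; lra.
  have Tt2 : 2^-1 * T1 <= 2^-1 * t by rewrite ler_pM2l// ltW.
  have := IH _ Tt2 tn2; rewrite eps_scale// -/c => hJ.
  have ept := eps_gt0 (t1_gt (le_trans ta tle)).
  have hJ' : (2 * c)^-1 * J (2^-1 * t) <= (A + Q0 / 2) * eps t.
    apply: le_trans (_ : (2 * c)^-1 * ((2 * A + Q0) * (c * eps t)) <= _).
      by rewrite ler_pM2l.
    by rewrite le_eqVlt; apply/orP; left; apply/eqP; field; rewrite gt_eqF.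
  have Qe : 0 <= Q0 * eps t by apply: mulr_ge0 => //; exact: ltW.
  move: hJ' Qe; set E := eps t; set D := _ * J _; rewrite /A => hJ' Qe; lra.
move=> t Tt.
have T1p' : 0 < T1 by [].
have [n hn] : exists n : nat, t <= 2 ^+ n * T1.
  have tp : 0 <= t / T1.
    by rewrite divr_ge0 ?(ltW T1p)//; apply: le_trans Tt; rewrite mulr_ge0 ?invr_ge0// ltW.
  have [n hn] : exists n : nat, t / T1 < n%:R by eexists; exact: archi_boundP.
  exists n.
  rewrite -ler_pdivrMr//; apply: le_trans (ltW hn) _.
  by rewrite -natrX ler_nat ltnW// ltn_expl.
exact: claim hn.
Qed.

Let norm_liminf (z : H) := forall eta, 0 < eta ->
  exists T : R, forall t, T <= t -> `|z| ^+ 2 - eta <= `|x t| ^+ 2.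

(** Because [p / t * eps] is minus the derivative of [eps], [J - 2^-1 * (eps * rho)] is
    nonincreasing as soon as |x|^2 >= rho. [J] being nonnegative and [eps] vanishing at infinity, it
    cannot become negative. *)
Let J_lower z eta : norm_liminf z -> 0 < eta -> exists T : R, forall t, T <= t ->
  2^-1 * (eps t * (`|z| ^+ 2 - eta)) <= J t.
Proof.
move=> hz eta0; have [T hT] := hz eta eta0.
set rho := `|z| ^+ 2 - eta in hT *.
exists (t1 + `|T|) => t Tt.
have tt : t1 <= t by have := normr_ge0 T; lra.
have t1p : 0 < t1 by apply: pos; rewrite /t1 ltrDl.
have TT : T <= t by have := ler_norm T; lra.
apply/ler_addgt0Pr => e e0.
have c0 : 0 < e / (1 + `|rho|) by rewrite divr_gt0// ltr_pwDl.
have [S hS] := eps_small c0.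
pose s := t + `|S|.
have ts : t <= s by rewrite lerDl.
have Ss : S <= s by rewrite /s; have := ler_norm S; lra.
pose F u : R := J u + - (2^-1 * (eps u * rho)).
have F_le : F s <= F t.
  apply: (@good_nonincreasing F t s) => //; first exact: t1_gt.
    apply: trackedB; last first.
      apply: gtrackM => //; [exact: t1_gt|exact: tracked_cst|].
      apply: gtrackM => //; [exact: t1_gt| |exact: tracked_cst].
      by apply: tracked_div_powR; [exact: lt_le_trans tt|exact: ltW|exact: ltW].
    apply: (@tracked_primitive _ (-1)) => // u tu; rewrite mulN1r; exact: DJ.
  move=> u /andP[tu us] gu; have t1u : t1 <= u by exact: le_trans (ltW tu).
  have up : 0 < u by exact: lt_le_trans t1u.
  apply: ex_intro2.
    exact: (is_derive_fun_add (DJ t1u) (is_derive_fun_opp (is_derive_fun_mul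
      (is_derive_fun_cst 2^-1 u) (is_derive_fun_mul (is_derive_div_powR beta p up)
      (is_derive_fun_cst rho u))))).
  rewrite /= -/(eps u) /dissip.
  have k1 : 0 <= gam u * `|xd u| ^+ 2.
    by apply: mulr_ge0; [apply: ltW; exact: gam_gt0 (t1_gt t1u)|exact: sqr_ge0].
  have k2 : 0 <= p / u * eps u.
    apply: mulr_ge0; last by apply: ltW; exact: eps_gt0 (t1_gt t1u).
    by apply: divr_ge0; exact: ltW.
  have k3 : p / u * eps u * rho <= p / u * eps u * `|x u| ^+ 2.
    by apply: ler_wpM2l => //; apply: hT; exact: le_trans (ltW tu).
  move: k1 k3; set A := gam u * _; set B := p / u * eps u; set X := `|x u| ^+ 2; lra.
have Js : 0 <= J s by apply: J_ge0; exact: le_trans ts.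
have es : eps s * (1 + `|rho|) <= e by rewrite -ler_pdivlMr ?ltr_pwDl//; exact: hS.
have es0 : 0 < eps s by apply: eps_gt0; apply: t1_gt; exact: le_trans ts.
have er : eps s * rho <= eps s * `|rho| by rewrite ler_pM2l// ler_norm.
have er0 : 0 <= eps s * `|rho| by apply: mulr_ge0 => //; exact: ltW.
move: F_le es es0 er er0; rewrite /F; set E := eps s; set E' := eps t; lra.
Qed.

(* Anchoring simultaneously at [z] and at the endpoint [x b] of the window gives a
   pointwise bound from integral estimates. *)
Let two_anchors z (xi e : R) : (forall i, f i z <= w i) ->
  0 < xi -> xi < 1 -> 0 < e ->
  exists T : R, forall b, T <= b ->
    [/\ 0 < b, t1 <= (1 - xi) * b, (1 - xi) * b <= b & forall eta, 0 <= eta ->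
      (forall t, (1 - xi) * b <= t -> 2^-1 * (eps t * (`|z| ^+ 2 - eta)) <= J t) ->
      4^-1 * (eps b * `|z - x b| ^+ 2) - 2^-1 * (eps ((1 - xi) * b) * eta)
        - 2^-1 * ((eps ((1 - xi) * b) - eps b) * M ^+ 2)
      <= e * J ((1 - xi) * b) + e * eps b].
Proof.
move=> fz xi0 xi1 e0.
pose C := 2^-1 * (M + `|z|) ^+ 2 + 2^-1 * (M + M) ^+ 2.
have C0 : 0 <= C by rewrite addr_ge0// mulr_ge0 ?invr_ge0 ?sqr_ge0.
have [T hT] := window_eventually xi0 xi1 C0 e0.
exists T => b Tb; have [b0 ta ab hw] := hT b Tb; split=> // eta eta0 hJ.
set a := (1 - xi) * b in ta ab hw hJ *.
have tb := t1_gt (le_trans ta ab).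
have eb0 := eps_gt0 tb.
set y := x b.
have yM : `|y| <= M by apply: xM; exact: ltW.
apply: (hw (fun t => sqdist z t + sqdist y t) (fun t => sqdist' z t + sqdist' y t)); split.
- move=> t at_ _; have tt := t1_gt (le_trans ta at_).
  exact: is_derive_fun_add (sqdist_derive z tt) (sqdist_derive y tt).
- by have [? _] := tracked_sqdist z (t1_gt ta) ab; have [? _] := tracked_sqdist y (t1_gt ta) ab; exact: trackedD.
- by have [_ ?] := tracked_sqdist z (t1_gt ta) ab; have [_ ?] := tracked_sqdist y (t1_gt ta) ab; exact: trackedD.
- move=> t /andP[at_ tlb] gt; have tt := le_trans ta (ltW at_).
  apply: ex_intro2.
    exact: is_derive_fun_add (sqdist'_derive z (t1_gt tt) gt) (sqdist'_derive y (t1_gt tt) gt).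
  have hz i : J t <= energy i t - f i z.
    by have := w_energy i tt; have := fz i; lra.
  (* The energy at [t] is at least the energy at [b], which contains the regularization term at
     [x b]. *)
  have hy i : 2^-1 * (eps b * `|y| ^+ 2) <= energy i t - f i y.
    have h1 := J_energy i tt (ltW tlb); have h2 := J_le tt (ltW tlb).
    have h3 := sqr_ge0 `|xd b|; have h4 : energy i b = f i y + 2^-1 * (eps b * `|y| ^+ 2) + 2^-1 * `|xd b| ^+ 2 by [].
    by rewrite h4 in h1; set A := _ * (_ * _) in h1 *; lra.
  have Sz := second_order' (t1_gt tt) gt hz.
  have Sy := second_order' (t1_gt tt) gt hy.
  have et0 := eps_gt0 (t1_gt tt).
  have eab : eps t <= eps a by exact: eps_le (ltW at_).
  have ebt : eps b <= eps t by exact: eps_le (ltW tlb).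
  have dist : `|z - y| ^+ 2 <= 4 * (sqdist z t + sqdist y t).
    have := parallelogram ip (x t - y) (x t - z).
    have -> : x t - y - (x t - z) = z - y by rewrite opprB addrC addrA subrK.
    have := sqr_ge0 `|2^-1 *: (x t - y) + 2^-1 *: (x t - z)|.
    by rewrite /sqdist => ? ->; lra.
  have d1 : eps b * `|z - y| ^+ 2 <= eps t * (4 * (sqdist z t + sqdist y t)).
    by apply: ler_pM => //; exact: ltW.
  (* At the anchor [x b] the cancellation is exact up to the variation of [eps] over the window. *)
  have d2 : (eps t - eps b) * `|y| ^+ 2 <= (eps a - eps b) * M ^+ 2.
    apply: ler_pM; rewrite ?subr_ge0 ?sqr_ge0 ?lerD2r//.
    by rewrite ler_pXn2r ?nnegrE//; exact: le_trans yM.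
  have d3 : eps t * eta <= eps a * eta by apply: ler_wpM2r.
  have d4 := hJ t (ltW at_).
  move: Sz Sy d1 d2 d3 d4; rewrite -/y.
  set Ea := eps a; set Eb := eps b; set Et := eps t; set Ga := gam t.
  set sz := sqdist z t; set sy := sqdist y t; set N := `|z - y| ^+ 2.
  set Y := `|y| ^+ 2; set Z := `|z| ^+ 2; lra.
- move=> t at_ _; have tt := ltW (t1_gt (le_trans ta at_)).
  have /andP[z1 z2] := sqdist_bound z tt; have /andP[y1 y2] := sqdist_bound y tt.
  rewrite addr_ge0//=; apply: lerD => //; apply: le_trans y2 _.
  have y0 := normr_ge0 y.
  apply: ler_wpM2l; first by rewrite invr_ge0.
  by rewrite ler_pXn2r ?nnegrE ?lerD2l// addr_ge0//; exact: le_trans yM.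
Qed.

Let residual_cvg z : (forall i, f i z <= w i) -> norm_liminf z ->
  x t @[t --> +oo] --> z.
Proof.
move=> fz hz; apply/cvgrPdist_le => d d0.
pose D := d ^+ 2; have D0 : 0 < D by exact: exprn_gt0.
have M0 := sqr_ge0 M.
have M1 : 0 < 16 * (1 + M ^+ 2) by rewrite mulr_gt0// ltr_pwDl.
pose s := Num.min 1 (D / (16 * (1 + M ^+ 2))).
have s0 : 0 < s by rewrite lt_min ltr01 divr_gt0.
have s1 : s <= 1 by rewrite ge_min lexx.
have sD : s * (16 * (1 + M ^+ 2)) <= D by rewrite -ler_pdivlMr// ge_min lexx orbT.
(* With this ratio, [eps (c * b) = (1 + s) * eps b] exactly; the window is [[c * b, b]]. *)
pose c := (1 + s) `^ (- p^-1).
have r0 : 0 < 1 + s by rewrite addr_gt0.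
have c0 : 0 < c by exact: powR_gt0.
have cE : (c `^ p)^-1 = 1 + s.
  by rewrite /c -powRrM mulNr mulVf ?gt_eqF// powRN invrK powRr1// ltW.
have c1 : c < 1.
  rewrite ltNge; apply/negP => c1.
  have : 1 <= c `^ p.
    apply: le_trans (_ : (1 : R) `^ p <= _); first by rewrite powR1.
    by apply: ge0_ler_powR; rewrite ?nnegrE//; exact: ltW.
  have -> : c `^ p = (1 + s)^-1 by rewrite -cE invrK.
  by rewrite invf_ge1// gerDl leNgt s0.
have [B [TB [B0 tTB hB]]] := J_bounded fz.
have B1 : 0 < 16 * (2 * B + 1) by rewrite mulr_gt0// ltr_wpDl// mulr_ge0.
pose e := D / (16 * (2 * B + 1)); have e0 : 0 < e by rewrite divr_gt0.
pose eta := D / 16; have eta0 : 0 < eta by rewrite divr_gt0.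
have [TL hL] := J_lower hz eta0.
have xi0 : 0 < 1 - c by rewrite subr_gt0.
have xi1 : 1 - c < 1 by rewrite gtrBl.
have [T hT] := two_anchors fz xi0 xi1 e0.
have cc : 1 - (1 - c) = c by ring.
rewrite cc in hT.
have close b : `|T| + (`|TB| + `|TL|) / c <= b -> `|z - x b| <= d.
  move=> hb.
  have u0 : 0 <= (`|TB| + `|TL|) / c by rewrite divr_ge0 ?addr_ge0// ltW.
  have Tb : T <= b by have := ler_norm T; lra.
  have uc : `|TB| + `|TL| <= c * b.
    by rewrite mulrC -ler_pdivrMr//; have := normr_ge0 T; lra.
  have [b0 ta ab h] := hT b Tb.
  have aTB : TB <= c * b by have := ler_norm TB; have := normr_ge0 TL; lra.
  have aTL : TL <= c * b by have := ler_norm TL; have := normr_ge0 TB; lra.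
  have hJL t : c * b <= t -> 2^-1 * (eps t * (`|z| ^+ 2 - eta)) <= J t.
    by move=> at_; apply: hL; exact: le_trans at_.
  have := h eta (ltW eta0) hJL.
  have hJB := hB _ aTB.
  have eb0 := eps_gt0 (t1_gt (le_trans ta ab)).
  rewrite eps_scale// cE in hJB *.
  set N := `|z - x b| ^+ 2.
  have eJ : e * J (c * b) <= e * (B * ((1 + s) * eps b)) by rewrite ler_pM2l.
  move=> hN.
  have {}hN : eps b * N <= eps b * (2 * (1 + s) * eta + 2 * s * M ^+ 2 + 4 * e * (B * (1 + s) + 1)).
    by move: hN eJ; set E := eps b; set X := e * J _ => hN eJ; lra.
  rewrite ler_pM2l// in hN.
  rewrite -(@ler_pXn2r _ 2) ?nnegrE ?normr_ge0 ?(ltW d0)// -/D -/N.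
  apply: le_trans hN _; apply: anchor_error_le => //; exact: ltW.
near=> b; apply: close; near: b.
exact: nbhs_pinfty_ge (num_real _).
Unshelve. all: by end_near. Qed.

Lemma residual_limit :
  [/\ forall z, ~ forall i, f i z < w i,
      forall d, 0 < d -> exists T : R, forall i t, T <= t -> f i (x t) <= w i + d &
      forall z, (forall i, f i z <= w i) ->
        (forall eta, 0 < eta -> exists T : R,
           forall t, T <= t -> `|z| ^+ 2 - eta <= `|x t| ^+ 2) ->
        x t @[t --> +oo] --> z].
Proof.
split; [exact: limit_undominated| |exact: residual_cvg].
move=> d d0; have [T hT] := energy_w d0; exists (t1 + `|T|) => i t Tt.
have tt : t0 < t by apply: t1_gt; have := normr_ge0 T; lra.
have TT : T <= t.
  have : 0 < t1 by apply: pos; rewrite /t1 ltrDl.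
  by have := ler_norm T; lra.
apply: le_trans (hT i t TT); rewrite /energy -addrA lerDl addr_ge0//.
by apply: mulr_ge0; rewrite ?invr_ge0// mulr_ge0 ?sqr_ge0//; apply: ltW; exact: eps_gt0.
Qed.

End residual.

(** The energies and [J] are eliminated, leaving only [w]. The lower bound on the norms stays a
    premise, to be supplied where completeness of [H] is available. *)
Lemma trajectory_limit : exists w : 'I_m -> R,
  [/\ forall z, ~ forall i, f i z < w i,
      forall d, 0 < d -> exists T : R, forall i t, T <= t -> f i (x t) <= w i + d &
      forall z, (forall i, f i z <= w i) ->
        (forall eta, 0 < eta -> exists T : R,
           forall t, T <= t -> `|z| ^+ 2 - eta <= `|x t| ^+ 2) ->
        x t @[t --> +oo] --> z].
Proof.
have [J [w [[h1 h2 h3 h4 h5] [h6 h7]]]] := residual_dissipation.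
by exists w; exact: (residual_limit h1 h2 h3 h4 h5 h6 h7).
Qed.

End trajectory.
(* The points of nearly minimal norm of the nested sets [level_set f (w + d)]
   form a Cauchy sequence as [d] tends to [0], by the parallelogram identity. *)
Lemma min_norm_level_liminf (R : realType) (H : completeNormedModType R)
    (inner : H -> H -> R) (m : nat) (f : 'I_m -> H -> R) (w : 'I_m -> R) (z : H) :
  is_inner_product inner -> (forall i, convex_fun (f i)) ->
  (forall i, continuous (f i)) -> is_min_norm (level_set f w) z ->
  forall eta, 0 < eta -> exists2 d : R, 0 < d &
    forall y, (forall i, f i y <= w i + d) -> `|z| ^+ 2 - eta <= `|y| ^+ 2.
Proof.
move=> ip cf cont [_ zmin] eta eta0; apply: contrapT => /forall2NP far.
have {}far d : 0 < d -> exists y, (forall i, f i y <= w i + d) /\ `|y| ^+ 2 < `|z| ^+ 2 - eta.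
  move=> d0; have [//|/existsNP[y /not_implyP[fy /negP]]] := far d.
  by rewrite -ltNge; exists y.
pose dn (n : nat) : R := harmonic n.
have dn0 n : 0 < dn n by rewrite /dn /harmonic/= invr_gt0.
have dn_le n k : (n <= k)%N -> dn k <= dn n.
  by move=> nk; rewrite /dn /harmonic/= lef_pV2 ?posrE// ler_nat ltnS.
pose K n := [set `|y| ^+ 2 | y in [set y | forall i, f i y <= w i + dn n]].
have K_lb n : lbound (K n) 0 by move=> _ [y _ <-]; exact: sqr_ge0.
have K_inf n : has_inf (K n).
  split; last by exists 0.
  by have [y [fy _]] := far _ (dn0 n); exists (`|y| ^+ 2), y.
(* The least squared norms of the shrinking sets increase with [n] and stay below [|z| ^+ 2 - eta],
   by the assumption being refuted. *)
pose N n := inf (K n).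
have N_le n y : (forall i, f i y <= w i + dn n) -> N n <= `|y| ^+ 2.
  by move=> fy; apply: (ge_inf (K_inf n).2); exists y.
have N_bound n : N n <= `|z| ^+ 2 - eta.
  by have [y [fy yz]] := far _ (dn0 n); exact: le_trans (N_le n y fy) (ltW yz).
have /choice[y_ hy] n : exists y, (forall i, f i y <= w i + dn n) /\ `|y| ^+ 2 < N n + dn n.
  by have [_ [y fy <-] yN] := inf_adherent (dn0 n) (K_inf n); exists y.
pose mu := sup (range N).
have N_sup : has_sup (range N).
  by split; [exists (N 0%N), 0%N|exists (`|z| ^+ 2 - eta) => _ [n _ <-]].
have N_mu n : N n <= mu by apply: (ub_le_sup N_sup.2); exists n.
have dist n k : (n <= k)%N -> `|y_ n - y_ k| ^+ 2 <= 2 * (mu - N n) + 4 * dn n.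
  move=> nk; have [fn yn] := hy n; have [fk yk] := hy k.
  (* By convexity the midpoint lies in the larger of the two sets. *)
  have mid : N n <= `|2^-1 *: y_ n + 2^-1 *: y_ k| ^+ 2.
    apply: N_le => i; have half : 0 <= (2^-1 : R) <= 1 by apply/andP; split; lra.
    have := cf i _ (y_ n) (y_ k) half.
    have -> : 1 - 2^-1 = 2^-1 :> R by lra.
    have := fn i; have := fk i; have := dn_le n k nk; lra.
  have := parallelogram ip (y_ n) (y_ k); have := N_mu k; have := dn_le n k nk; lra.
have yb_lim : cvg (y_ @ \oo).
  apply: cauchy_cvg; apply: cauchy_exP => e e0.
  (* In [dist], [2 * (e ^+ 2 / 4)] and [4 * (e ^+ 2 / 8)] add up to [e ^+ 2]. *)
  have e2 : 0 < e ^+ 2 / 4 by rewrite divr_gt0// exprn_gt0.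
  have [_ [n1 _ <-] hn1] := sup_adherent e2 N_sup.
  have [n2 hn2] : exists n2, dn n2 < e ^+ 2 / 8.
    have e8 : 0 < e ^+ 2 / 8 by rewrite divr_gt0// exprn_gt0.
    have /cvgrPdist_lt/(_ _ e8)[n2 _ /(_ n2 (leqnn _))] := @cvg_harmonic R.
    by rewrite sub0r normrN gtr0_norm; [exists n2|exact: dn0].
  pose n0 := maxn n1 n2.
  have Nn0 : N n1 <= N n0.
    apply: lb_le_inf; first exact: (K_inf n0).1.
    move=> _ [y fy <-]; apply: N_le => i; apply: le_trans (fy i) _.
    by rewrite lerD2l dn_le// leq_maxl.
  exists (y_ n0); exists n0 => // k /= nk; rewrite -ball_normE /=.
  rewrite -(@ltr_pXn2r _ 2) ?nnegrE ?(ltW e0)//.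
  have := dist n0 k nk; have := dn_le n2 n0 (leq_maxr _ _); rewrite -/mu in hn1; lra.
pose yb := lim (y_ @ \oo).
have fyb : level_set f w yb.
  move=> i; apply: (@ler_cvg_to _ \oo _ _ (fun n => f i (y_ n)) (fun n => w i + dn n)).
  - exact: continuous_cvg (cont i yb) yb_lim.
  - rewrite -[X in _ --> X]addr0; apply: cvgD; first exact: cvg_cst.
    exact: cvg_harmonic.
  - by apply: nearW => n; have [fn _] := hy n.
have yb_norm : `|yb| ^+ 2 <= `|z| ^+ 2 - eta.
  apply: (@ler_cvg_to _ \oo _ _ (fun n => `|y_ n| ^+ 2) (fun n => `|z| ^+ 2 - eta + dn n)).
  - have -> : (fun n => `|y_ n| ^+ 2) = (fun n => `|y_ n| * `|y_ n|).
      by apply/funext => n; rewrite expr2.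
    by rewrite expr2; apply: cvgM; exact: cvg_norm.
  - rewrite -[X in _ --> X]addr0; apply: cvgD; first exact: cvg_cst.
    exact: cvg_harmonic.
  - by apply: nearW => n; have [_ yn] := hy n; have := N_bound n; lra.
have := zmin yb fyb; rewrite -(@ler_pXn2r _ 2) ?nnegrE//; lra.
Qed.

(** The two hypotheses say that the maximum of the shifted objectives has infimum 0, so it is
    minimized exactly where it is at most 0. *)
Lemma argmin_max_level_set (R : realType) (H : normedModType R) (m : nat)
    (f : 'I_m -> H -> R) (w : 'I_m -> R) :
  (forall z, ~ forall i, f i z < w i) ->
  (forall d, 0 < d -> exists z, forall i, f i z <= w i + d) ->
  argmin_max f w = level_set f w.
Proof.
move=> undom inf_le0; apply/seteqP; split=> z.
  move=> zmin i; apply/ler_addgt0Pr => d d0; have [y fy] := inf_le0 d d0.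
  have : (max_shift f w z <= d%:E)%E.
    apply: le_trans (zmin y) _; apply: bigmax_le; first by rewrite leNye.
    by move=> j _; rewrite lee_fin lerBlDl; exact: fy.
  have := @le_bigmax _ _ _ -oo%E (fun j => (f j z - w j)%:E) i.
  by move=> /le_trans h /h; rewrite lee_fin lerBlDl.
move=> fz y; apply: (@le_trans _ _ 0%E).
  apply: bigmax_le; first by rewrite leNye.
  by move=> j _; rewrite lee_fin subr_le0; exact: fz.
have /existsNP[i /negP] := undom y; rewrite -leNgt => wi.
apply: le_trans (@le_bigmax _ _ _ -oo%E (fun j => (f j y - w j)%:E) i).
by rewrite lee_fin subr_ge0.
Qed.

Theorem mainTheorem14
  (R : realType) (H : completeNormedModType R) (inner : H -> H -> R)
  (m : nat) (f : 'I_m -> H -> R) (g : 'I_m -> H -> H)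
  (t0 alpha beta q p : R) (x0 v0 : H) (x xd xdd : R -> H) :
  is_inner_product inner ->
  (0 < m)%N ->
  (forall i, convex_fun (f i)) ->
  (forall i, is_gradient inner (f i) (g i)) ->
  (forall i, lipschitz_fun (g i)) ->
  0 < t0 -> 0 < alpha -> 0 < beta ->
  0 < q < 1 -> 0 < p <= 2 -> p < q + 1 ->
  (* (A3) *)
  (let b0 := fun i => f i x0
        + (beta / (2 * t0 `^ p) * `|x0| ^+ 2 + 2^-1 * `|v0| ^+ 2) in
   (forall y, level_set f b0 y ->
      exists z, level_set f (fun i => f i y) z /\ weak_pareto f z) /\
   has_ubound [set inf [set `|z| | z in [set z | forall i, f i z = f i zs]]
              | zs in level_set f b0 `&` weak_pareto f]) ->
  (* (A4) *)
  (forall w : 'rV[R]_m, argmin_max f (fun i => w ord0 i) !=set0) ->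
  (exists P : 'rV[R]_m -> H,
      (forall w : 'rV[R]_m, is_min_norm (argmin_max f (fun i => w ord0 i)) (P w)) /\
      continuous P) ->
  (* x is a trajectory solution of (MTRIGS) with initial data (x0, v0) *)
  x t0 = x0 -> xd t0 = v0 ->
  (forall t, t0 < t -> is_derive t 1 x (xd t)) ->
  h^-1 *: (x (t0 + h) - x t0) @[h --> 0^'+] --> xd t0 ->
  {within `[t0, +oo[, continuous xd} ->
  (forall T, t0 <= T -> abs_cont_on t0 T xd) ->
  {ae (@lebesgue_measure R), forall t, t0 < t -> is_derive t 1 xd (xdd t)} ->
  {ae (@lebesgue_measure R), forall t, t0 <= t ->
     is_min_norm
       [set c + (beta / t `^ p) *: x t + xdd t | c in conv_hull (fun i => g i (x t))]
       (- (alpha / t `^ q) *: xd t)} ->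
  (* x is bounded *)
  (exists M : R, forall t, t0 <= t -> `|x t| <= M) ->
  exists xs : H,
    x t @[t --> +oo] --> xs /\ weak_pareto f xs /\
    is_min_norm (level_set f (fun i => f i xs)) xs.
Proof.
move=> ip m0 cf fg lg t0_gt0 al be /andP[q0 q1] /andP[p0 _] pq _ _ [P [hP _]].
move=> _ _ Dx _ cxd ac ae1 ae2 [M xM].
have [w [undom lim_le cvg_x]] :=
  trajectory_limit ip m0 cf fg lg t0_gt0 al be q0 q1 p0 pq Dx cxd ac ae1 ae2 xM.
have levelE : argmin_max f w = level_set f w.
  apply: argmin_max_level_set => // d d0; have [T hT] := lim_le d d0.
  by exists (x T) => i; exact: hT.
(* (A4) is applied at the limiting levels of the energies, known only once the trajectory has been
   analysed. *)
have := hP (\row_i w i); set z := P _.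
have -> : (fun i => (\row_i w i) ord0 i) = w by apply/funext => i; rewrite mxE.
rewrite levelE => zmin; have fz : forall i, f i z <= w i := zmin.1.
exists z; split; last split.
- apply: cvg_x => // eta eta0.
  have cont i : continuous (f i).
    by move=> y; have [/differentiable_continuous] := fg i y.
  have [d d0 hd] := min_norm_level_liminf ip cf cont zmin eta0.
  have [T hT] := lim_le d d0; exists T => t Tt; apply: hd => i.
  exact: hT.
- move=> [y fy]; apply: (undom y) => i; exact: lt_le_trans (fy i) (fz i).
(* The level set at [f z] lies inside [level_set f w] and still contains [z], so minimality is
   inherited. *)
- split=> // y fy; apply: zmin.2 => i; exact: le_trans (fy i) (fz i).
Qed.
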